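(* Let $d\ge 2$ and let $H$ be any $d$-regular graph. Let $G$ be a random $n$-lift of $H$. Then for all $n$ sufficiently large, with probability at least $1-n^{-2\sqrt{d}}$ we have $\lambda^*(G)\le 430656\sqrt{d}$.
   Context: Let $H$ be a graph with vertex set $[h]=\{1,\dots,h\}$. An $n$-lift $G$ of $H$ has vertex set $\{(i,j): i\in[h], j\in[n]\}$; the set $V_i=\{(i,j):j\in[n]\}$ is the fibre of $i$. For each edge $ii'$ of $H$ a perfect matching between $V_i$ and $V_{i'}$ is placed, and these are the only edges of $G$. A random $n$-lift is obtained by choosing these matchings independently and uniformly at random (each among the $n!$ possibilities). Let $M$ be the adjacency matrix of $G$. The subspace of vectors $x\in\mathbb{R}^{V(G)}$ that are balanced on every fibre (i.e. $\sum_{v\in V_i}x_v=0$ for all $i\in[h]$) is $M$-invariant; the eigenvalues of $M$ on this subspace are the new eigenvalues of $G$, and $\lambda^*(G)$ denotes the largest absolute value of a new eigenvalue. *)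

(* Defs.v *)
From HB Require Import structures.
From mathcomp Require Import all_boot all_fingroup.
From Stdlib Require Import Reals ClassicalEpsilon.
Set Implicit Arguments. Unset Strict Implicit. Unset Printing Implicit Defensive.

Definition d_regular (h d : nat) (e : rel 'I_h) : Prop :=
  symmetric e /\ irreflexive e /\ forall i : 'I_h, #|[set j | e i j]| = d.

Definition edgeH (h : nat) (e : rel 'I_h) : Type :=
  {p : 'I_h * 'I_h | ((p.1 < p.2)%N && e p.1 p.2)}.

(* An n-lift: for each edge ii' (i<i') a perfect matching between V_i and V_i',
   encoded by a permutation s of [n]: (i,a) -- (i', s a). *)
Definition nlift (h : nat) (e : rel 'I_h) (n : nat) : finType :=
  {ffun edgeH e -> {perm 'I_n}}.

Definition lift_adj (h : nat) (e : rel 'I_h) (n : nat) (L : nlift e n)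
  (u v : 'I_h * 'I_n) : bool :=
  [exists p : edgeH e,
     ((u.1 == (val p).1) && (v.1 == (val p).2) && (v.2 == L p u.2))
  || ((v.1 == (val p).1) && (u.1 == (val p).2) && (u.2 == L p v.2))].

Definition adj_mx (h : nat) (e : rel 'I_h) (n : nat) (L : nlift e n)
  (u v : 'I_h * 'I_n) : R :=
  if lift_adj L u v then 1%R else 0%R.

Definition mx_act (h : nat) (e : rel 'I_h) (n : nat) (L : nlift e n)
  (x : 'I_h * 'I_n -> R) (u : 'I_h * 'I_n) : R :=
  \big[Rplus/0%R]_(v : 'I_h * 'I_n) (adj_mx L u v * x v)%R.

Definition balanced (h n : nat) (x : 'I_h * 'I_n -> R) : Prop :=
  forall i : 'I_h, \big[Rplus/0%R]_(a : 'I_n) x (i, a) = 0%R.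

(* lam is a new eigenvalue: an eigenvalue of M on the (M-invariant)
   balanced subspace. *)
Definition new_eigenvalue (h : nat) (e : rel 'I_h) (n : nat) (L : nlift e n)
  (lam : R) : Prop :=
  exists x : 'I_h * 'I_n -> R,
    balanced x /\ (exists v, x v <> 0%R) /\
    forall u, mx_act L x u = (lam * x u)%R.

Definition lambda_star_le (h : nat) (e : rel 'I_h) (n : nat) (L : nlift e n)
  (c : R) : Prop :=
  forall lam, new_eigenvalue L lam -> (Rabs lam <= c)%R.

Definition asbool (P : Prop) : bool :=
  if excluded_middle_informative P then true else false.

(* Probability, for a uniformly random n-lift (each matching uniform among
   the n! possibilities, independently), that the event P holds. *)
Definition lift_prob (h : nat) (e : rel 'I_h) (n : nat) (P : nlift e n -> Prop) : R :=
  (INR #|[set L : nlift e n | asbool (P L)]| / INR #|[set: nlift e n]|)%R.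

(* Main.v *)
(* Fix a balanced vector x and let S act on each fibre by a random reflection
   a |-> c - a. Since x averages to zero on fibres, <x, M x> is the average of
   <z, M z> over the reflections, where z = x - S x is S-antisymmetric and has
   norm at most 2 |x|. Composing the matchings with the transpositions
   (a, c - a) on a random set of pairs preserves the law of the lift and, as z is
   antisymmetric, only inserts random signs on the edges; splitting each pair
   makes these signs independent. By Jensen the m-th moment of the largest new
   eigenvalue is at most 2 * 8^m times the expected trace of the m-th power of a
   randomly signed lift, that is (up to constants) the expected number of walks
   of length m in the lift that use every edge an even number of times.

   A walk using N distinct edges lies in the lift with probability at most
   (n - m)^-N. Suppose that the graph traced by an even walk has chi edges besides
   those of its first-visit tree. Apart from at most 7 chi special edges, at most
   two of the edges used an odd number of times so far meet the current vertex, so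
   a step closing such an edge has at most 2 choices, against d choices (and n
   labels) for a step opening an edge. A special edge, once visited, costs at most
   3 chi + 2. With m of order sqrt d * ln n this gives at most
   n^O(1) (2 sqrt d)^m for each pattern of step types: factors exponential in
   chi are absorbed by the probability n^-chi of the excess edges. *)

Require Import Defs.
From Stdlib Require Import Reals ZArith Lra Lia Classical ClassicalEpsilon.

(** * Numerical estimates *)

Section Numerics.
Local Open Scope R_scope.

(** [exp (t / 20)] is the square of [exp (t / 40)], and [(t / 40) ^ 2 >= C * t] because
    [1600 = 40 ^ 2]. *)
Lemma linear_le_exp (C t : R) : 0 < C -> 1600 * C <= t -> C * t <= exp (t / 20).
Proof.
intros HC Ht.
assert (H : 1 + t / 40 <= exp (t / 40)) by apply exp_ineq1_le.
replace (t / 20) with (t / 40 + t / 40) by lra.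
rewrite exp_plus.
assert (C * t <= (t / 40) * (t / 40)) by nra.
apply Rle_trans with ((1 + t / 40) * (1 + t / 40)); [nra|].
apply Rmult_le_compat; lra.
Qed.

Lemma bernoulli_neg (y : R) (m : nat) : 0 <= y <= 1 -> 1 - INR m * y <= (1 - y) ^ m.
Proof.
intros Hy; induction m as [|m IH]; [simpl; lra|].
rewrite S_INR; simpl pow.
assert (0 <= INR m) by apply pos_INR.
apply Rle_trans with ((1 - y) * (1 - INR m * y)); [nra|].
apply Rmult_le_compat_l; lra.
Qed.

(** Bernoulli: [(1 - m / n) ^ m >= 1 - m ^ 2 / n >= 1 / 2]. *)
Lemma pow_le_twice (n q : R) (m : nat) :
  0 < n -> q = n - INR m -> 0 <= q -> 2 * (INR m * INR m) <= n -> n ^ m <= 2 * q ^ m.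
Proof.
intros Hn Hq Hq0 Hm.
assert (Hm0 := pos_INR m).
assert (B := bernoulli_neg (INR m / n) m).
assert (Hy : 0 <= INR m / n <= 1).
{ split; [apply Rle_mult_inv_pos; lra|]; apply Rmult_le_reg_r with n; [lra|].
  unfold Rdiv; rewrite Rmult_assoc, Rinv_l; lra. }
specialize (B Hy).
assert (Hh : INR m * (INR m / n) <= 1 / 2).
{ apply Rmult_le_reg_r with n; [lra|].
  replace (INR m * (INR m / n) * n) with (INR m * INR m) by (field; lra); lra. }
replace q with (n * (1 - INR m / n)) by (rewrite Hq; field; lra).
rewrite Rpow_mult_distr.
assert (0 < n ^ m) by (apply pow_lt; lra).
nra.
Qed.

Lemma exp_pow (y : R) (k : nat) : exp y ^ k = exp (INR k * y).
Proof.
induction k as [|k IH]; [simpl; now rewrite Rmult_0_l, exp_0|].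
rewrite S_INR; simpl pow; rewrite IH, <- exp_plus; f_equal; lra.
Qed.

(* [y <= exp y] at [y = (3 x + 2) / b]. *)
Lemma affine_pow_le (b : R) (m s x : nat) : 0 < b -> (s <= m)%nat ->
  (3 * INR x + 2) ^ s <= b ^ s * exp (2 * INR m / b) * exp (3 * INR m / b) ^ x.
Proof.
intros Hb Hs.
assert (Hx := pos_INR x).
assert (Hsm : INR s <= INR m) by (now apply le_INR).
set (y := (3 * INR x + 2) / b).
assert (Hy : 0 <= y) by (apply Rle_mult_inv_pos; lra).
assert (E : 3 * INR x + 2 = b * y) by (unfold y; field; lra).
rewrite E, Rpow_mult_distr, Rmult_assoc.
apply Rmult_le_compat_l; [apply pow_le; lra|].
rewrite exp_pow, <- exp_plus.
replace (2 * INR m / b + INR x * (3 * INR m / b)) with (INR m * y)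
  by (unfold y; field; lra).
apply Rle_trans with (exp y ^ s).
- apply pow_incr; split; [exact Hy|]; assert (1 + y <= exp y) by apply exp_ineq1_le; lra.
- rewrite exp_pow.
  destruct (Rle_lt_or_eq_dec (INR s * y) (INR m * y)) as [H|H].
  + apply Rmult_le_compat_r; lra.
  + left; now apply exp_increasing.
  + rewrite H; lra.
Qed.

Lemma exp_le_mono (x y : R) : x <= y -> exp x <= exp y.
Proof.
intros [H|H]; [left; now apply exp_increasing|rewrite H; lra].
Qed.

(** Gathers all analytic requirements on the walk length [m]. With [t = ln n] it is taken between
    [0.5 * sqrt d * t] and [0.6 * sqrt d * t]: large enough for the [m]-th power of the final
    constant to beat the powers of [n], small enough for [K1] to be at most [n ^ (9/10)]. *)
Lemma exists_walk_length (d h : nat) : (2 <= d)%nat ->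
  exists N : nat, forall n : nat, (N <= n)%nat ->
  exists (k : nat) (K0 K1 : R), let m := (k + k)%nat in let b := 2 * sqrt (INR d) in
  (0 < k)%nat /\ (m < n)%nat /\ 0 < K0 /\ 0 < K1 /\
  INR n ^ m <= 2 * (INR n - INR m) ^ m /\
  (forall x s : nat, (s <= m)%nat -> (3 * INR x + 2) ^ s <= b ^ s * K0 * K1 ^ x) /\
  INR m * INR d ^ 6 * K1 <= INR n - INR m /\
  4 * INR h * INR n * 64 ^ m * b ^ m * K0 <=
    Rpower (INR n) (- (2 * sqrt (INR d))) * (430656 * sqrt (INR d)) ^ m.
Proof.
intros Hd.
set (D := INR d); set (s := sqrt D).
assert (HD : 2 <= D) by (apply (le_INR 2); lia).
assert (Hs2 : s * s = D) by (apply sqrt_sqrt; lra).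
assert (Hs0 : 0 <= s) by apply sqrt_pos.
assert (Hs : 14 / 10 <= s) by nra.
assert (HsD : s <= D) by nra.
assert (Hh := pos_INR h).
assert (HD7 : 1 <= D ^ 7) by (apply pow_R1_Rle; lra).
(* With this [C], the bound [C * t <= exp (t / 20)] controls both [2 * m * D ^ 6] and [4 * h]; the
   threshold [exp (1600 * C)] for [n] provides the [t >= 1600 * C] that it requires. *)
set (C := 2 * D ^ 7 + 4 * INR h).
destruct (INR_unbounded (exp (1600 * C))) as [N HN].
exists N; intros n Hn.
assert (HnN : INR N <= INR n) by (now apply le_INR).
assert (Hnpos : 0 < INR n) by (assert (0 < exp (1600 * C)) by apply exp_pos; lra).
set (t := ln (INR n)).
assert (Hexp : exp t = INR n) by (now apply exp_ln).
assert (Ht : 1600 * C <= t).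
{ rewrite <- (ln_exp (1600 * C)); apply Rlt_le, ln_increasing; [apply exp_pos|lra]. }
assert (HC : 0 < C) by (unfold C; lra).
assert (Ht1 : 1600 <= t) by (unfold C in Ht; lra).
assert (HCt := linear_le_exp C t HC Ht).
set (L := s * t).
assert (HL : 2000 <= L) by (unfold L; nra).
destruct (archimed (L / 4)) as [Hup1 Hup2].
set (k := Z.to_nat (up (L / 4))).
assert (Hk : INR k = IZR (up (L / 4))).
{ unfold k; rewrite INR_IZR_INZ, Z2Nat.id; [reflexivity|].
  apply le_IZR; lra. }
assert (Hk1 : L / 4 <= INR k <= L / 4 + 1) by lra.
set (b := 2 * s).
exists k, (exp (2 * INR (k + k) / b)), (exp (3 * INR (k + k) / b)); intros m b'.
change b' with b; fold m.
assert (Hm : INR m = 2 * INR k) by (unfold m; rewrite plus_INR; lra).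
assert (Hm1 : L / 2 <= INR m <= 6 / 10 * L) by lra.
assert (Hb : 0 < b) by (unfold b; lra).
assert (Hmb : INR m / b <= 3 / 10 * t).
{ apply Rmult_le_reg_r with b; [exact Hb|].
  replace (INR m / b * b) with (INR m) by (field; lra); unfold b, L in *; lra. }
assert (HmDt : INR m <= D * t) by (unfold L in *; nra).
assert (HDD : 2 * D <= C).
{ assert (D * 1 <= D * D ^ 6) by (apply Rmult_le_compat_l; [lra|apply pow_R1_Rle; lra]).
  unfold C; simpl in *; lra. }
assert (Hm20 : 2 * INR m <= exp (t / 20)) by nra.
(* [n] is split into [n ^ (9/10)], reserved for [K1], and two factors [n ^ (1/20)], reserved for the
   factors polynomial in [t] and [D]. *)
assert (Hsplit : exp (9 / 10 * t) * exp (t / 20) * exp (t / 20) = INR n).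
{ rewrite <- !exp_plus, <- Hexp; f_equal; lra. }
assert (H20 : 1 <= exp (t / 20)) by (assert (1 + t / 20 <= exp (t / 20)) by apply exp_ineq1_le; lra).
assert (H90 : 1 <= exp (9 / 10 * t))
  by (assert (1 + 9 / 10 * t <= exp (9 / 10 * t)) by apply exp_ineq1_le; lra).
set (E := exp (t / 20)) in *; set (G := exp (9 / 10 * t)) in *.
assert (HEn : G * E <= INR n) by nra.
assert (HEE : E * E <= INR n) by nra.
assert (Hmn : 2 * INR m <= INR n) by nra.
repeat split.
- apply INR_lt; simpl; lra.
- apply INR_lt; lra.
- apply exp_pos.
- apply exp_pos.
- assert (Hm0 := pos_INR m).
  apply pow_le_twice; [lra|reflexivity|lra|nra].
- intros x j Hj; now apply affine_pow_le.
- apply Rle_trans with (INR n / 2); [|lra].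
  assert (HK1 : exp (3 * INR m / b) <= G).
  { apply exp_le_mono; replace (3 * INR m / b) with (3 * (INR m / b)) by (unfold Rdiv; ring); lra. }
  assert (Hm6 : 2 * (INR m * D ^ 6) <= E).
  { apply Rle_trans with (C * t); [|exact HCt].
    assert (0 < D ^ 6) by (apply pow_lt; lra).
    apply Rle_trans with (2 * (D * t * D ^ 6)); [nra|].
    replace (2 * (D * t * D ^ 6)) with (2 * D ^ 7 * t) by ring.
    apply Rmult_le_compat_r; [lra|unfold C; lra]. }
  assert (0 <= INR m * D ^ 6) by (apply Rmult_le_pos; [apply pos_INR|apply pow_le; lra]).
  assert (0 < exp (3 * INR m / b)) by apply exp_pos.
  nra.
- unfold Rpower; fold t; fold s.
  (* Once [b ^ m] is cancelled, [215328 >= 64 * 3 ^ 7] absorbs [64 ^ m] and leaves [exp (7 * m)]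
     against the powers of [n]. *)
  replace (430656 * s) with (215328 * b) by (unfold b; lra).
  rewrite Rpow_mult_distr.
  assert (Hbm : 0 < b ^ m) by (now apply pow_lt).
  assert (H4h : 4 * INR h <= exp (t / 2)).
  { apply Rle_trans with E; [unfold C in HCt; nra|apply exp_le_mono; lra]. }
  assert (HK0 : exp (2 * INR m / b) <= exp (6 / 10 * t)).
  { apply exp_le_mono; replace (2 * INR m / b) with (2 * (INR m / b)) by (unfold Rdiv; ring); lra. }
  assert (H7 : exp (7 * INR m) * 64 ^ m <= 215328 ^ m).
  { replace (7 * INR m) with (INR m * 7) by ring.
    rewrite <- exp_pow, <- Rpow_mult_distr; apply pow_incr.
    assert (H3 := exp_le_3); assert (0 < exp 1) by apply exp_pos.
    assert (H37 : exp 7 = exp 1 ^ 7) by (rewrite exp_pow; f_equal; simpl; lra).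
    assert (exp 1 ^ 7 <= 3 ^ 7) by (apply pow_incr; lra).
    assert (0 < exp 7) by apply exp_pos.
    rewrite H37 in *; simpl in *; lra. }
  (* As [m >= s * t / 2], this amounts to [2.1 <= 1.5 * s], which is exactly [s >= 1.4]; that bound
     on [sqrt d] comes from [d >= 2]. *)
  assert (Hexpo : exp (t / 2) * exp t * exp (6 / 10 * t) <= exp (- (2 * s) * t) * exp (7 * INR m)).
  { rewrite <- !exp_plus; apply exp_le_mono.
    assert (7 * (L / 2) <= 7 * INR m) by lra; unfold L in *; nra. }
  assert (P64 : 0 < 64 ^ m) by (apply pow_lt; lra).
  apply Rle_trans with (exp (t / 2) * exp t * exp (6 / 10 * t) * (64 ^ m * b ^ m)).
  + rewrite Hexp.
    assert (A1 : 4 * INR h * INR n <= exp (t / 2) * INR n) by (apply Rmult_le_compat_r; lra).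
    assert (A2 : 4 * INR h * INR n * exp (2 * INR m / b) <= exp (t / 2) * INR n * exp (6 / 10 * t)).
    { apply Rmult_le_compat; [nra|left; apply exp_pos|exact A1|exact HK0]. }
    replace (4 * INR h * INR n * 64 ^ m * b ^ m * exp (2 * INR m / b))
      with (4 * INR h * INR n * exp (2 * INR m / b) * (64 ^ m * b ^ m)) by ring.
    apply Rmult_le_compat_r; [nra|exact A2].
  + apply Rle_trans with (exp (- (2 * s) * t) * exp (7 * INR m) * (64 ^ m * b ^ m)).
    * apply Rmult_le_compat_r; [nra|exact Hexpo].
    * replace (exp (- (2 * s) * t) * exp (7 * INR m) * (64 ^ m * b ^ m))
        with (exp (- (2 * s) * t) * ((exp (7 * INR m) * 64 ^ m) * b ^ m)) by ring.
      apply Rmult_le_compat_l; [left; apply exp_pos|].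
      apply Rmult_le_compat_r; [lra|exact H7].
Qed.

End Numerics.

From mathcomp Require Import all_boot all_fingroup all_order all_algebra zify ring lra.
From mathcomp Require Import Rstruct.
Set Implicit Arguments. Unset Strict Implicit. Unset Printing Implicit Defensive.

(** * The graph traced by a walk *)

Lemma set2_inj (T : finType) (a b c d : T) :
  [set a; b] = [set c; d] -> (a = c /\ b = d) \/ (a = d /\ b = c).
Proof.
move=> E.
have : a \in [set c; d] by rewrite -E set21.
have : b \in [set c; d] by rewrite -E set22.
have : c \in [set a; b] by rewrite E set21.
have : d \in [set a; b] by rewrite E set22.
rewrite !inE => /orP[]/eqP h1 /orP[]/eqP h2 /orP[]/eqP h3 /orP[]/eqP h4; subst; tauto.
Qed.

Lemma set2_injr (T : finType) (a : T) : injective (fun b => [set a; b]).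
Proof. by move=> b c /set2_inj [[]|[-> ->]]. Qed.

Lemma index_nth_leq (T : eqType) (x0 : T) s i : i < size s -> index (nth x0 s i) s <= i.
Proof.
move=> lt_i; rewrite -ltnS; apply: index_ltn.
by rewrite (take_nth x0) // mem_rcons inE eqxx.
Qed.

Section Walk.
Variables (V : finType) (v0 : V).
Implicit Types (w : seq V) (u v y z : V) (t : nat) (E : {set V}).

(** A walk is stored as the list [w] of the vertices after its start [v0], so [size w] is its number
    of steps; [v0] is also the default value past its end. *)
Definition vtx w t := nth v0 (v0 :: w) t.
Definition edg w t := [set vtx w t; vtx w t.+1].
Definition past w t := mkseq (edg w) t.
Definition first_visit w t := edg w t \notin past w t.
Definition new_vertex w t := vtx w t.+1 \notin mkseq (vtx w) t.+1.
Definition excess w t := first_visit w t && ~~ new_vertex w t.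
(** The cyclomatic number of the traced graph: each new vertex is reached by one tree edge, and the
    remaining distinct edges are the excess ones. *)
Definition chi w := #|[set t : 'I_(size w) | excess w t]|.
Definition excess_edges w := [set edg w t | t : 'I_(size w) & excess w t].
Definition excess_ends w :=
  [set vtx w t | t : 'I_(size w) & excess w t] :|:
  [set vtx w t.+1 | t : 'I_(size w) & excess w t].
(* The parent in the tree of first-visit edges; [v0] is its own parent, and the
   value is irrelevant at unvisited vertices. *)
Definition parent w v := vtx w (index v (v0 :: w)).-1.
(** The tree paths from the endpoints of excess edges to the root. All cycles of the traced graph
    lie in it together with the excess edges, so the tree edge above a vertex outside it is a
    bridge. *)
Definition skeleton w :=
  [set v in v0 :: w | [exists z in excess_ends w, fconnect (parent w) z v]].
Definition children w u := [set c in skeleton w | (c != v0) && (parent w c == u)].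
Definition branching w u := (1 < #|children w u|) || (u \in excess_ends w).
(* Cutting these edges leaves at most one edge of the skeleton below each vertex,
   and none below a vertex incident to an excess edge. *)
Definition special w E :=
  (E \in excess_edges w) ||
  [exists c in skeleton w, [&& c != v0, E == [set c; parent w c] & branching w (parent w c)]].
Definition open_edge w t E := odd (count_mem E (past w t)).

Lemma vtx0 w : vtx w 0 = v0. Proof. by []. Qed.

Lemma vtx_mem w t : t <= size w -> vtx w t \in v0 :: w.
Proof. by move=> ?; apply: mem_nth. Qed.

Lemma mkseq_vtx w t : t <= (size w).+1 -> mkseq (vtx w) t = take t (v0 :: w).
Proof.
move=> le_t; apply: (@eq_from_nth _ v0) => [|i]; rewrite size_mkseq.
  by rewrite size_take /=; case: ltngtP le_t => //; lia.
by move=> lt_i; rewrite nth_mkseq // nth_take.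
Qed.

Section Fixed.
Variable w : seq V.
Local Notation W := (v0 :: w).
Local Notation m := (size w).
Local Notation x := (vtx w).
Local Notation pa := (parent w).
Local Notation Z := (excess_ends w).
Local Notation Y := (skeleton w).

Lemma index_vtx t : t <= m -> index (x t) W <= t.
Proof. by move=> ?; apply: index_nth_leq. Qed.

Lemma new_vertexE t : t < m -> new_vertex w t -> index (x t.+1) W = t.+1.
Proof.
move=> lt_t; rewrite /new_vertex mkseq_vtx; last lia.
move=> notin; apply/eqP; rewrite eqn_leq index_vtx //=.
by rewrite leqNgt; apply/negP => lt; case/negP: notin; rewrite in_take ?vtx_mem.
Qed.

Lemma index_eq0 v : (index v W == 0) = (v == v0).
Proof. by rewrite /= [v0 == v]eq_sym; case: (v == v0). Qed.

Lemma new_vertex_neq t : t < m -> new_vertex w t -> x t.+1 != v0.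
Proof. by move=> lt_t /(new_vertexE lt_t) E; rewrite -index_eq0 E. Qed.

Lemma new_vertex_parent t : t < m -> new_vertex w t -> pa (x t.+1) = x t.
Proof. by move=> lt_t /(new_vertexE lt_t) E; rewrite /parent E. Qed.

Lemma parent0 : pa v0 = v0.
Proof. by rewrite /parent /= eqxx. Qed.

Lemma parent_mem v : v \in W -> pa v \in W.
Proof. by rewrite -index_mem => lt; apply: vtx_mem; move: lt => /=; lia. Qed.

(** [index v W] is the first-visit time of [v], and the parent is the vertex occupied one step
    earlier. This time is the decreasing measure for arguments along the tree. *)
Lemma parent_index v : v \in W -> v != v0 -> index (pa v) W < index v W.
Proof.
move=> vW v_neq; have := v_neq; rewrite -index_eq0 -lt0n => gt0.
have lt : index v W < m.+1 by rewrite -[m.+1]/(size W) index_mem.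
have := @index_vtx (index v W).-1; rewrite -/(parent w v); lia.
Qed.

(** Otherwise each of the two vertices would be the parent of the other, and each first-visit time
    smaller than the other. *)
Lemma parent_inj y v : y \in W -> v \in W -> y != v0 -> v != v0 ->
  [set y; pa y] = [set v; pa v] -> y = v.
Proof.
move=> yW vW y0 v0n /set2_inj[[]//|[E1 E2]].
have := parent_index yW y0; have := parent_index vW v0n.
rewrite E2 -E1; lia.
Qed.

Lemma fconnect_parent0 v : fconnect pa v0 v -> v = v0.
Proof.
move/iter_findex; move: (findex _ _ _) => n <-.
by elim: n => //= n ->; rewrite parent0.
Qed.

Lemma fconnect_index y v : y \in W -> fconnect pa y v -> index v W <= index y W.
Proof.
move=> yW /iter_findex; move: (findex _ _ _) => n <-; elim: n => // n IH.
rewrite iterS; apply: leq_trans IH; set u := iter _ _ _.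
have uW : u \in W by rewrite /u; elim: (n) => [//|k]; rewrite iterS; apply: parent_mem.
by have [->|u0] := eqVneq u v0; [rewrite parent0 | rewrite ltnW ?parent_index].
Qed.

Lemma first_visitP t : t < m -> exists f, [/\ f <= t, edg w f = edg w t & first_visit w f].
Proof.
elim/ltn_ind: t => t IH lt_t.
have [|] := boolP (first_visit w t); first by exists t.
rewrite negbK => /mapP[s]; rewrite mem_iota add0n /= => lt_s Es.
have [f [le_f Ef ff]] := IH s lt_s (ltn_trans lt_s lt_t).
by exists f; split=> //; [lia | rewrite Ef].
Qed.

Lemma excess_edge t : t < m -> excess w t ->
  [/\ edg w t \in excess_edges w, x t \in Z & x t.+1 \in Z].
Proof.
move=> lt_t ex; have h : Ordinal lt_t \in [set t : 'I_m | excess w t] by rewrite inE.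
split; first by apply/imsetP; exists (Ordinal lt_t).
  by apply/setUP; left; apply/imsetP; exists (Ordinal lt_t).
by apply/setUP; right; apply/imsetP; exists (Ordinal lt_t).
Qed.

Lemma excess_edgesP E : E \in excess_edges w ->
  exists2 t, t < m & excess w t /\ E = edg w t.
Proof. by case/imsetP => t; rewrite inE => ex ->; exists t. Qed.

(** The first visit of the edge decides: it either discovers a new vertex, whose parent is then the
    other end, or is an excess step. *)
Lemma edg_tree_or_excess t : t < m ->
  edg w t \in excess_edges w \/
  exists y, [/\ y \in W, y != v0 & edg w t = [set y; pa y]].
Proof.
move=> lt_t; have [f [le_f <- ff]] := first_visitP lt_t.
have lt_f : f < m by lia.
have [nf|nf] := boolP (new_vertex w f); [right | left].
  exists (x f.+1); rewrite vtx_mem // new_vertex_neq // new_vertex_parent //; split=> //.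
  by rewrite setUC.
by have [] := excess_edge lt_f; first rewrite /excess ff nf.
Qed.

Lemma card_excess_ends : #|Z| <= 2 * chi w.
Proof.
rewrite mul2n -addnn (leq_trans (leq_card_setU _ _)) // leq_add //; exact: leq_imset_card.
Qed.

Lemma card_excess_edges : #|excess_edges w| <= chi w.
Proof. exact: leq_imset_card. Qed.

Lemma skeleton_ends z : z \in Z -> z \in Y.
Proof.
move=> zZ; rewrite inE; apply/andP; split; last first.
  by apply/existsP; exists z; rewrite zZ connect0.
by case/setUP: zZ => /imsetP[t] _ ->; apply: vtx_mem => //; apply: ltnW.
Qed.

Lemma skeleton_parent v : v \in Y -> pa v \in Y.
Proof.
rewrite !inE => /andP[vW /existsP[z /andP[zZ zv]]].
have:= parent_mem vW; rewrite !inE => -> /=.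
by apply/existsP; exists z; rewrite zZ /= (connect_trans zv) ?fconnect1.
Qed.

Lemma skeleton_mem v : v \in Y -> v \in W.
Proof. by rewrite inE => /andP[]. Qed.

(** The last vertex before [v] on a parent chain from an excess endpoint is a child of [v], so
    without children the chain has length zero. The root needs a separate argument, being its own
    parent. *)
Lemma skeleton_leaf v : v \in Y -> #|children w v| = 0 -> v \in Z.
Proof.
move=> vY /eqP; rewrite cards_eq0 => /eqP ch0.
have [vW] := setIdP vY; case/existsP => z /andP[zZ /iter_findex].
case: (findex _ _ _) => [<- // |n /=]; set c := iter n _ _ => Ec.
have cY : c \in Y by rewrite /c; elim: (n) => [|k] /=; [apply: skeleton_ends | apply: skeleton_parent].
have [c0|cN] := eqVneq c v0; last first.
  suff : c \in children w v by rewrite ch0 inE.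
  by rewrite inE cY cN Ec eqxx.
have vv0 : v = v0 by rewrite -Ec c0 parent0.
(* Here [v] is the root and the chain may repeat it: trailing repetitions are removed until the
   chain starts at the root or its last step comes from a genuine child. *)
elim: n @c Ec cY c0 => [|n IH] /= Ec cY c0; first by rewrite vv0 -c0.
set d := iter n pa z in c0 Ec IH *.
have [d0|dN] := eqVneq d v0.
  apply: IH => //; first by rewrite d0 parent0.
  by rewrite d0 -c0.
suff : d \in children w v by rewrite ch0 inE.
rewrite inE dN /d -/d c0 vv0 eqxx !andbT.
by rewrite /d; elim: (n) => [|k] /=; [apply: skeleton_ends | apply: skeleton_parent].
Qed.

Lemma sum_children : \sum_(u in Y) #|children w u| <= #|Y|.
Proof.
rewrite -sum1_card [X in _ <= X](partition_big pa (mem Y)) /=; last exact: skeleton_parent.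
apply: leq_sum => u uY; rewrite -sum1_card.
rewrite [X in X <= _]big_mkcond [X in _ <= X]big_mkcond /=.
apply: leq_sum => c _; rewrite [c \in children _ _]inE.
by case: (c \in Y) => //=; case: (pa c == u); rewrite ?andbF //; case: ifP.
Qed.

(** In a tree, branching is paid for by leaves, and the leaves of the skeleton are excess
    endpoints. *)
Lemma sum_children_pred : \sum_(u in Y) (#|children w u|).-1 <= #|Z|.
Proof.
have : \sum_(u in Y) (#|children w u|.-1 + 1) <=
       \sum_(u in Y) (#|children w u| + (#|children w u| == 0)).
  by apply: leq_sum => u _; case: #|_|; lia.
rewrite !big_split /= sum1_card => h.
have h2 : \sum_(u in Y) (#|children w u| == 0) <= #|Z|.
  rewrite -sum1_card big_mkcond [X in _ <= X]big_mkcond /=.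
  apply: leq_sum => u _; case: ifP => // uY; case: eqP => [|_]; last by case: ifP.
  by move=> /(skeleton_leaf uY) ->.
have := sum_children; lia.
Qed.

Lemma card_children u : #|children w u| <= (2 * chi w).+1.
Proof.
have [uY|uNY] := boolP (u \in Y).
  have := sum_children_pred; rewrite (bigD1 u) //=; have := card_excess_ends.
  by case: #|children w u| => //= k; lia.
suff -> : children w u = set0 by rewrite cards0.
apply/setP => c; rewrite inE [in RHS]inE; apply/negP => /and3P[cY _ /eqP Ec].
by case/negP: uNY; rewrite -Ec skeleton_parent.
Qed.

(** A branching vertex with [k] children has [k <= 2 * (k - 1)] if [k >= 2], and otherwise is an
    excess endpoint, which pays the missing unit. Summing gives [2 * (2 * chi) + 2 * chi]. *)
Lemma card_special_new :
  #|[set t : 'I_m | first_visit w t && new_vertex w t && special w (edg w t)]| <= 6 * chi w.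
Proof.
pose C := [set c in Y | (c != v0) && branching w (pa c)].
have le1 : #|[set t : 'I_m | first_visit w t && new_vertex w t && special w (edg w t)]| <= #|C|.
  rewrite -(@card_in_imset _ _ (fun t : 'I_m => x t.+1)).
    apply: subset_leq_card; apply/subsetP => c /imsetP[t]; rewrite inE => /andP[/andP[ft nt] sp] ->.
    have lt_t := ltn_ord t.
    case/orP: sp => [/excess_edgesP[s lt_s [/andP[fs /negP ns] Es]]|].
      case: (ltngtP s t) => [lt|lt|E]; last by rewrite E in ns.
        by case/negP: ft; rewrite Es; apply/mapP; exists s => //; rewrite mem_iota add0n.
      by case/negP: fs; rewrite -Es; apply/mapP; exists (t : nat) => //; rewrite mem_iota add0n.
    case/existsP => c' /and4P[c'Y c'0 /eqP Ec' br].
    suff -> : x t.+1 = c' by rewrite inE c'Y c'0.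
    apply: parent_inj; rewrite ?vtx_mem ?new_vertex_neq ?new_vertex_parent ?skeleton_mem //.
    by rewrite -Ec' setUC.
  move=> s t; rewrite !inE => /andP[/andP[_ ns] _] /andP[/andP[_ nt] _] E.
  apply: val_inj => /=; have := new_vertexE (ltn_ord s) ns.
  rewrite E (new_vertexE (ltn_ord t) nt); lia.
apply: leq_trans le1 _.
have -> : #|C| = \sum_(u in Y) (if branching w u then #|children w u| else 0).
  rewrite -sum1_card (partition_big pa (mem Y)) /=; last first.
    by move=> c; rewrite inE => /andP[cY _]; apply: skeleton_parent.
  apply: eq_bigr => u uY; case: ifP => br.
    rewrite -sum1_card; apply: eq_bigl => c; rewrite !inE.
    by case: (pa c =P u) => [->|]; rewrite ?andbF // br !andbT.
  rewrite big1 // => c /andP[]; rewrite !inE => /and3P[_ _ br'] /eqP Ec.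
  by rewrite Ec br in br'.
apply: (@leq_trans (\sum_(u in Y) (2 * (#|children w u|).-1 + (u \in Z)))).
  apply: leq_sum => u uY; rewrite /branching; case: (u \in Z); rewrite ?orbT ?orbF /=; first lia.
  by case: ifP; lia.
rewrite big_split /= -big_distrr /=.
have := sum_children_pred; have := card_excess_ends.
have : \sum_(u in Y) (u \in Z) <= #|Z|.
  rewrite -sum1_card big_mkcond [X in _ <= X]big_mkcond /=.
  by apply: leq_sum => u _; case: ifP => // _; case: (u \in Z).
lia.
Qed.

(** At most [chi] excess edges, one parent and [2 * chi + 1] children in the skeleton. *)
Lemma card_special_nbr u : u \in W ->
  #|[set v | special w [set u; v]]| <= 3 * chi w + 2.
Proof.
move=> uW.
apply: (@leq_trans #|[set v | [set u; v] \in excess_edges w] :|: (pa u |: children w u)|).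
  apply: subset_leq_card; apply/subsetP => v; rewrite inE => /orP[ex|].
    by rewrite inE [_ \in [set _ | _]]inE ex.
  case/existsP => c /and4P[cY c0 /eqP/set2_inj[[-> ->]|[E1 E2]] br].
    by rewrite !inE eqxx orbT.
  by rewrite !in_setU [_ \in children _ _]inE E2 cY c0 E1 eqxx !orbT.
have h1 : #|[set v | [set u; v] \in excess_edges w]| <= chi w.
  apply: leq_trans card_excess_edges.
  rewrite -(card_imset _ (@set2_injr _ u)); apply: subset_leq_card.
  by apply/subsetP => E /imsetP[v]; rewrite inE => h ->.
have := card_children u.
have [+ _] := leq_card_setU [set v | [set u; v] \in excess_edges w] (pa u |: children w u).
by rewrite cardsU1; case: (_ \notin _); lia.
Qed.

(* Without excess endpoints below [v], the tree edge above [v] is a bridge, so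
   it has been crossed an odd number of times iff the walk is now below [v]. *)
Lemma open_bridge v t : v \in W -> v != v0 -> v \notin Y -> t <= m ->
  open_edge w t [set v; pa v] = fconnect pa (x t) v.
Proof.
move=> vW vN vY; rewrite /open_edge; elim: t => [_|t IH lt_t].
  by rewrite vtx0 /=; symmetry; apply/negP => /fconnect_parent0 E; rewrite E eqxx in vN.
have notin z : z \in Z -> fconnect pa z v = false.
  move=> zZ; apply/negP => zv; case/negP: vY; rewrite inE vW.
  by apply/existsP; exists z; rewrite zZ.
have pavF : fconnect pa (pa v) v = false.
  apply/negP => /(fconnect_index (parent_mem vW)).
  have := parent_index vW vN; lia.
rewrite /past mkseqS -cats1 count_cat oddD /= addn0 -/(past w t) IH; last lia.
have [ex|[y [yW yN Ey]]] := edg_tree_or_excess lt_t.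
  have [s lt_s [es Es]] := excess_edgesP ex; have [_ z1 z2] := excess_edge lt_s es.
  have zt u : u \in [set x t; x t.+1] -> u \in Z.
    by rewrite -/(edg w t) Es => /set2P[] ->.
  rewrite (notin (x t)) ?zt ?set21 // (notin (x t.+1)) ?zt ?set22 //.
  case: eqP => // E; case/negP: vY; apply: skeleton_ends; apply: zt.
  by rewrite -/(edg w t) E set21.
(* Crossing the tree edge above [y] changes whether the walk is below [v] exactly when [y = v], in
   step with the parity of the count. *)
have step : fconnect pa y v (+) fconnect pa (pa y) v = (y == v).
  have [->|yv] := eqVneq y v; first by rewrite connect0 pavF.
  by rewrite [fconnect pa y v]fconnect_eqVf (negbTE yv) /= addbb.
have -> : (edg w t == [set v; pa v]) = (y == v).
  rewrite Ey; apply/eqP/eqP => [|->//]; exact: parent_inj.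
case: (set2_inj Ey) => -[-> ->]; by rewrite -step; do 2!case: (connect _ _ _).
Qed.

(** The two candidates are the parent of the current vertex [u] and its only skeleton child, if it
    has just one. An open edge to a child outside the skeleton would put the walk below that child;
    an edge to one of several skeleton children is special. *)
Lemma card_open_nbr t : t <= m ->
  #|[set v | open_edge w t [set x t; v] && ~~ special w [set x t; v]]| <= 2.
Proof.
move=> le_t; set u := x t.
set A := [set v | _].
pose c0 := [set v in children w u | #|children w u| <= 1].
have c0le : #|c0| <= 1.
  have [le1|gt1] := leqP #|children w u| 1.
    by apply: leq_trans le1; apply: subset_leq_card; apply/subsetP => v /setIdP[].
  suff -> : c0 = set0 by rewrite cards0.
  by apply/setP => v; rewrite !inE leqNgt gt1 andbF.
apply: (@leq_trans #|pa u |: c0|); last by rewrite cardsU1; case: (_ \notin _); lia.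
apply: subset_leq_card; apply/subsetP => v; rewrite inE => /andP[op nsp].
have : 0 < count_mem [set u; v] (past w t) by rewrite lt0n; apply: contraTneq op; rewrite /open_edge => ->.
rewrite -has_count has_pred1 => /mapP[s]; rewrite mem_iota add0n /= => lt_s Es.
have lt_sm : s < m by lia.
have [ex|[y [yW yN]]] := edg_tree_or_excess lt_sm.
  by rewrite /special Es ex in nsp.
rewrite -Es => /set2_inj[[-> ->]|[Eu Ev]]; first by rewrite !inE eqxx.
subst y; have vY : v \in Y.
  apply: contraT => vNY; move: op; rewrite setUC Eu open_bridge // -/u Eu.
  move=> /(fconnect_index (parent_mem yW)); have := parent_index yW yN; lia.
rewrite in_setU1; apply/orP; right.
rewrite in_set [_ \in children _ _]in_set vY yN -Eu eqxx /=.
move: nsp; rewrite /special negb_or => /andP[_]; rewrite negb_exists => /forallP/(_ v).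
rewrite vY yN -Eu [in X in X == _]setUC eqxx /= /branching negb_or => /andP[].
by rewrite -leqNgt.
Qed.

End Fixed.

End Walk.

(** * Counting even walks by step types *)

(** The uses of one element alternate between opening and closing; they cancel except for the
    elements still open at time [t]. *)
Lemma sum_parity (T : finType) (q : pred T) (f : nat -> T) t :
  \sum_(i < t) (q (f i) && ~~ odd (count_mem (f i) (mkseq f i))) =
  \sum_(i < t) (q (f i) && odd (count_mem (f i) (mkseq f i))) +
  #|[set y | q y && odd (count_mem y (mkseq f t))]|.
Proof.
elim: t => [|t IH].
  rewrite !big_ord0 /=; symmetry; apply/eqP; rewrite cards_eq0; apply/eqP/setP => y.
  by rewrite !inE andbF.
set S' := [set y | _].
rewrite !big_ord_recr /= {}IH -!addnA; congr addn; rewrite [in RHS]addnC.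
set b := odd (count_mem (f t) _); set S := [set y | _].
have inS' y : y \in S' = q y && (odd (count_mem y (mkseq f t)) (+) (f t == y)).
  by rewrite inE mkseqS -cats1 count_cat oddD /= addn0; case: (f t == y).
have [qt|qt] /= := boolP (q (f t)); last first.
  rewrite !addn0; congr #|pred_of_set _|; apply/setP => y; rewrite inS' inE.
  by case: eqP => [<-|_]; rewrite ?(negbTE qt) // addbF.
have inS : (f t \in S) = b by rewrite inE qt.
case Eb: b; rewrite Eb in inS.
  rewrite addn0 (cardsD1 (f t) S) inS addnC; congr addn; congr #|pred_of_set _|.
  apply/setP => y; rewrite in_setD1 inS' !inE eq_sym.
  by case: eqP => [<-|_] /=; rewrite ?addbF // -/b Eb andbF.
rewrite addn0 addnC -[true : nat]/1 (_ : S' = f t |: S); first by rewrite cardsU1 inS.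
apply/setP => y; rewrite in_setU1 inS' !inE [y == _]eq_sym.
by case: eqP => [<-|_] /=; rewrite ?addbF // -/b Eb qt.
Qed.

(** The bound on [#|A s|] is demanded only for prefixes that extend to a word of [P], so that
    properties of the whole word may be used to prove it. *)
Lemma card_tuples_prefix (V : finType) m (P : pred (seq V)) (A : seq V -> {set V})
    (c : nat -> nat) :
  (forall s v w, size (s ++ v :: w) = m -> P (s ++ v :: w) ->
     v \in A s /\ #|A s| <= c (size s)) ->
  #|[set w : m.-tuple V | P w]| <= \prod_(i < m) c i.
Proof.
elim: m P A c => [|m IH] P A c H.
  rewrite big_ord0 (leq_trans (max_card _)) // card_tuple expn0 //.
have [->|[w0]] := set_0Vmem [set w : m.+1.-tuple V | P w]; first by rewrite cards0.
rewrite inE (tuple_eta w0) => Pw0.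
have sz (w : m.+1.-tuple V) : size ([::] ++ thead w :: behead w) = m.+1.
  by rewrite /= size_behead size_tuple.
have [_ cA] := H [::] (thead w0) (behead w0) (sz w0) Pw0.
rewrite -sum1_card (partition_big (fun w => thead w) (mem (A [::]))) /=; last first.
  move=> w; rewrite inE (tuple_eta w) => Pw.
  by have [] := H [::] (thead w) (behead w) (sz w) Pw.
rewrite big_ord_recl; apply: leq_trans (leq_mul cA (leqnn _)).
rewrite -sum_nat_const; apply: leq_sum => v _; rewrite sum1_card.
apply: leq_trans (IH (fun w => P (v :: w)) (fun s => A (v :: s)) (fun i => c i.+1) _); last first.
  by move=> s u w szw Pw; apply: (H (v :: s) u w (congr1 S szw)).
rewrite -(@card_in_imset _ _ (fun w : m.+1.-tuple V => behead_tuple w)).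
  apply: subset_leq_card; apply/subsetP => _ /imsetP[w + ->].
  by rewrite unfold_in inE => /andP[+ /eqP <-]; rewrite {1}(tuple_eta w) inE.
move=> w w'; rewrite !unfold_in => /andP[_ /eqP E] /andP[_ /eqP E'] Eb.
rewrite (tuple_eta w) (tuple_eta w') E E'; apply: val_inj => /=.
by have := congr1 val Eb => /= ->.
Qed.

Section Types.
Variables (V : finType) (v0 : V).
Implicit Types w s : seq V.

(* The last component tells, for the first visit of an edge, whether its endpoint is
   new, and for a later visit, whether the edge had been used an odd number of times. *)
Definition step_type w t : bool * bool * bool :=
  (special v0 w (edg v0 w t), first_visit v0 w t,
   if first_visit v0 w t then new_vertex v0 w t else open_edge v0 w t (edg v0 w t)).

Definition nedges w := #|[set E in past v0 w (size w)]|.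

Lemma nedgesE w : nedges w = \sum_(t < size w) first_visit v0 w t.
Proof.
rewrite /nedges; elim: (size w) => [|t IH].
  by rewrite big_ord0; apply/eqP; rewrite cards_eq0; apply/eqP/setP => y; rewrite !inE.
rewrite big_ord_recr -{}IH.
have -> : [set E in past v0 w t.+1] = edg v0 w t |: [set E in past v0 w t].
  by apply/setP => y; rewrite in_setU1 !in_set /past mkseqS mem_rcons in_cons.
by rewrite cardsU1 addnC /= in_set.
Qed.

Lemma vtx_cat s w t : t <= size s -> vtx v0 (s ++ w) t = vtx v0 s t.
Proof. by move=> le_t; rewrite /vtx -cat_cons nth_cat /= ltnS le_t. Qed.

Lemma vtx_last s v w : vtx v0 (s ++ v :: w) (size s).+1 = v.
Proof. by rewrite /vtx /= nth_cat ltnn subnn. Qed.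

Lemma past_cat s w t : t <= size s -> past v0 (s ++ w) t = past v0 s t.
Proof.
move=> le_t; apply/eq_in_map => i; rewrite mem_iota add0n /= => lt_i.
by rewrite /edg !vtx_cat //; lia.
Qed.

Lemma sum_nonspecial_parity w :
  (forall E, ~~ odd (count_mem E (past v0 w (size w)))) ->
  \sum_(i < size w) (~~ special v0 w (edg v0 w i) && ~~ open_edge v0 w i (edg v0 w i)) =
  \sum_(i < size w) (~~ special v0 w (edg v0 w i) && open_edge v0 w i (edg v0 w i)).
Proof.
move=> ev; rewrite /open_edge (@sum_parity _ (fun E => ~~ special v0 w E)).
rewrite [X in _ + X](_ : _ = 0) ?addn0 //; apply/eqP; rewrite cards_eq0.
by apply/eqP/setP => E; rewrite !inE (negbTE (ev E)) andbF.
Qed.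

End Types.

Section Counting.
Variables (h n d m : nat) (e : rel 'I_h).
Local Notation V := ('I_h * 'I_n)%type.
Variable v0 : V.
Hypothesis deg : forall i, #|[set j | e i j]| = d.

(** The first two conditions are what containment in a lift leaves on the walk alone: it projects to
    a walk of [H], and the matchings allow a vertex at most one traced neighbour in each fibre. *)
Definition even_walk (w : seq V) : Prop :=
  [/\ forall t, t < size w -> e (vtx v0 w t).1 (vtx v0 w t.+1).1,
      forall u v v', [set u; v] \in past v0 w (size w) ->
         [set u; v'] \in past v0 w (size w) -> v.1 = v'.1 -> v = v'
    & forall E, ~~ odd (count_mem E (past v0 w (size w)))].

Variable th : nat -> bool * bool * bool.

Definition of_type (w : seq V) :=
  even_walk w /\ forall t, t < size w -> step_type v0 w t = th t.

Definition nexcess := \sum_(i < m) ((th i).1.2 && ~~ (th i).2 : nat).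

(** In order: a new vertex is any point of the [d] neighbouring fibres; an excess step ends at a
    vertex already seen; a special edge is taken again; a nonspecial open edge is closed; a
    nonspecial known edge is reopened, with one candidate per neighbouring fibre. *)
Definition cost t :=
  let: (sp, fi, b) := th t in
  if fi then (if b then d * n else m)
  else if sp then 3 * nexcess + 2 else if b then 2 else d.

(* Whether an edge of the prefix [s] is special depends on the whole walk, but it is
   recorded by the type of the first visit of that edge. *)
Definition flagged s E := (th (index E (past v0 s (size s)))).1.1.

Definition options s : {set V} :=
  let u := vtx v0 s (size s) in
  let: (sp, fi, b) := th (size s) in
  if fi then (if b then [set v : V | e u.1 v.1] else [set v in v0 :: s])
  else if sp then [set v | ([set u; v] \in past v0 s (size s)) && flagged s [set u; v]]
  else if b then [set v | open_edge v0 s (size s) [set u; v] && ~~ flagged s [set u; v]]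
  else [set v | ([set u; v] \in past v0 s (size s)) && e u.1 v.1].

Lemma chi_type w : size w = m -> of_type w -> chi v0 w = nexcess.
Proof.
move=> sz [_ ty]; rewrite /chi -sum1_card big_mkcond /nexcess -sz /=.
apply: eq_bigr => i _; rewrite inE -ty //= /excess.
by case: (first_visit v0 w i); case: (new_vertex v0 w i).
Qed.

Lemma card_fibre (i : 'I_h) : #|[set v : V | e i v.1]| = d * n.
Proof.
have -> : d * n = #|setX [set j | e i j] [set: 'I_n]|.
  by rewrite cardsX deg cardsT card_ord.
by apply: eq_card => v; rewrite !inE andbT.
Qed.

Lemma optionsP s v w : size (s ++ v :: w) = m -> of_type (s ++ v :: w) ->
  v \in options s /\ #|options s| <= cost (size s).
Proof.
set W := s ++ v :: w => sz ofW; have chiW := chi_type sz ofW.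
have [[adj cons ev] ty] := ofW.
have lt_s : size s < size W by rewrite size_cat /=; lia.
have le_s : size s <= size W by lia.
have vW t : t <= size s -> vtx v0 W t = vtx v0 s t by apply: vtx_cat.
have pW : past v0 W (size s) = past v0 s (size s) by rewrite past_cat.
have psub E : E \in past v0 s (size s) -> E \in past v0 W (size W).
  rewrite -pW => /mapP[i]; rewrite !mem_iota => hi ->; apply/mapP; exists i => //.
  by rewrite mem_iota; case/andP: hi => _ lt_i; rewrite /= add0n (leq_trans lt_i).
have flagW E : E \in past v0 s (size s) -> flagged s E = special v0 W E.
  move=> Es; rewrite /flagged.
  have lt_i : index E (past v0 s (size s)) < size s.
    by have := Es; rewrite -index_mem size_mkseq.
  rewrite -ty; last exact: ltn_trans lt_i lt_s.
  rewrite /step_type /=; congr special.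
  by rewrite -[RHS](nth_index set0 Es) nth_mkseq // /edg !vW // ltnW.
have opW E : open_edge v0 W (size s) E = open_edge v0 s (size s) E.
  by rewrite /open_edge pW.
have uE : vtx v0 W (size s) = vtx v0 s (size s) by rewrite vW.
have vE : vtx v0 W (size s).+1 = v by rewrite vtx_last.
have := ty _ lt_s; rewrite /options /cost; case: (th (size s)) => [[sp fi] b] [].
have adjs := adj _ lt_s.
rewrite /edg {}uE {}vE in adjs *; set u := vtx v0 s (size s) in adjs *.
have uW : u \in v0 :: W by rewrite /u -vW // vtx_mem.
move=> spE fiE; rewrite fiE; case: fi fiE => fiE bE.
  case: b bE => bE; first by rewrite inE adjs card_fibre.
  split.
    have := negbT bE; rewrite /new_vertex vtx_last negbK mkseq_vtx; last exact: le_s.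
    by rewrite in_set /W -cat_cons take_size_cat.
  apply: leq_trans (_ : size (v0 :: s) <= _); first by rewrite cardsE card_size.
  by move: sz; rewrite /W size_cat /=; lia.
have inp : [set u; v] \in past v0 s (size s).
  by move: fiE => /negbT; rewrite negbK /edg vtx_last vW // pW.
case: sp spE => spE.
  split; first by rewrite inE inp flagW.
  rewrite -chiW; apply: leq_trans (card_special_nbr uW); apply: subset_leq_card.
  by apply/subsetP => y; rewrite !inE => /andP[yp]; rewrite flagW.
case: b bE => bE.
  split; first by rewrite inE -opW bE flagW // spE.
  apply: leq_trans (card_open_nbr v0 le_s); rewrite vW // -/u.
  apply: subset_leq_card; apply/subsetP => y; rewrite !inE => /andP[op].
  rewrite opW op flagW //.
  by move: op; rewrite /open_edge; case: (boolP (_ \in _)) => // /count_memPn ->.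
split; first by rewrite inE inp adjs.
(* The second condition of [even_walk] makes the projection to [H] injective on the known neighbours
   of [u]. *)
rewrite -(deg u.1) -(@card_in_imset _ _ (fun y : V => y.1)).
  by apply: subset_leq_card; apply/subsetP => _ /imsetP[y + ->]; rewrite !inE => /andP[].
move=> y y'; rewrite !inE => /andP[yp _] /andP[y'p _]; exact: (cons u _ _ (psub _ yp) (psub _ y'p)).
Qed.

Definition nfirst := \sum_(i < m) ((th i).1.2 : nat).

(** The witnesses count steps: [a] discover a vertex, [v] close a nonspecial edge, [s] reuse a
    special edge. Nonspecial openings and closings balance, so the factors [d] paid by openings
    number at most [v] plus the special tree edges. *)
Lemma card_of_type (P : pred (seq V)) :
  0 < d -> (forall w, size w = m -> P w -> of_type w) ->
  exists a v s, [/\ a <= m, a + nexcess = nfirst, 2 * v + s <= m &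
    #|[set w : m.-tuple V | P w]| <=
      d ^ (v + 6 * nexcess) * n ^ a * m ^ nexcess * (3 * nexcess + 2) ^ s * 2 ^ v].
Proof.
move=> d0 PT.
pose N (q : bool -> bool -> bool -> bool) :=
  \sum_(i < m) (q (th i).1.1 (th i).1.2 (th i).2 : nat).
pose a := N (fun _ fi b => fi && b).
have aE : a + nexcess = nfirst.
  rewrite /a /N /nexcess -big_split /nfirst; apply: eq_bigr => i _ /=.
  by case: (th i) => [[[] []] []].
have am : a <= m.
  rewrite -[X in _ <= X]card_ord -sum1_card; apply: leq_sum => i _.
  by case: (_ && _).
(* The relations between the counts are read off a walk that realises the types; without one the set
   is empty and [v = s = 0] will do. *)
have [->|[w0]] := set_0Vmem [set w : m.-tuple V | P w].
  by exists a, 0, 0; rewrite cards0.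
rewrite inE => /(PT _ (size_tuple _)) ofw; have szw := size_tuple w0.
have [ew ty] := ofw.
pose v := N (fun sp fi b => [&& ~~ sp, ~~ fi & b]).
pose s := N (fun sp fi b => sp && ~~ fi).
pose o := N (fun sp fi b => [&& ~~ sp, ~~ fi & ~~ b]).
have thE (i : 'I_m) : th i = step_type v0 w0 i by rewrite ty ?szw.
have openF i : first_visit v0 w0 i -> open_edge v0 w0 i (edg v0 w0 i) = false.
  by rewrite /first_visit /open_edge => /count_memPn ->.
(* A first visit opens its edge, so the nonspecial openings are the nonspecial first visits together
   with the [o] reopenings. *)
have parity : N (fun sp fi b => ~~ sp && fi) + o = v.
  have [_ _ /sum_nonspecial_parity] := ew; rewrite szw => par.
  rewrite /v /o /N -big_split /=; apply: etrans (etrans par _); apply: eq_bigr => i _.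
    rewrite thE /=; case: (special _ _ _) => //=; case: ifP => [/openF ->|_] //.
  rewrite thE /=; case: (special _ _ _) => //=; case: ifP => [/openF ->|_] //.
have newsp : N (fun sp fi b => [&& sp, fi & b]) <= 6 * nexcess.
  rewrite -(chi_type szw ofw); apply: leq_trans (card_special_new v0 w0).
  rewrite -sum1_card big_mkcond szw /=; apply: leq_sum => i _.
  rewrite thE inE /=; case: (special _ _ _) => //=; rewrite andbT.
  by case: ifP => // _; case: ifP.
have total : N (fun sp fi b => ~~ sp && fi) + v + o + s <= m.
  rewrite -[X in _ <= X]card_ord -sum1_card /N /v /o /s -!big_split /=.
  by apply: leq_sum => i _; case: (th i) => [[[] []] []].
(* A discovering step is nonspecial, hence counted by [parity], or special, hence counted by
   [newsp]. *)
have le_ao : a + o <= v + 6 * nexcess.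
  suff : a <= N (fun sp fi b => ~~ sp && fi) + N (fun sp fi b => [&& sp, fi & b]) by lia.
  rewrite /a /N -big_split /=; apply: leq_sum => i _.
  by case: (th i) => [[[] []] []].
exists a, v, s; split=> //; first lia.
have prefix := @card_tuples_prefix _ m P options cost.
apply: leq_trans (prefix _) _.
  by move=> s' u w szu Pu; apply: (optionsP szu (PT _ szu Pu)).
have -> : \prod_(i < m) cost i =
    (d * n) ^ a * m ^ nexcess * (3 * nexcess + 2) ^ s * 2 ^ v * d ^ o.
  rewrite /a /nexcess -/nexcess /s /v /o /N !expn_sum -!big_split /=.
  apply: eq_bigr => i _; rewrite /cost; case: (th i) => [[[] []] []] /=;
    rewrite ?expn1 ?expn0; lia.
have := leq_pexp2l d0 le_ao.
move=> le_d; rewrite expnMn.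
rewrite (_ : _ * d ^ o = d ^ (a + o) * n ^ a * m ^ nexcess * (3 * nexcess + 2) ^ s * 2 ^ v).
  by do 4!rewrite leq_mul2r; rewrite le_d !orbT.
rewrite expnD; lia.
Qed.

End Counting.

(** * Walks in random lifts *)

Section Lift.
Variables (h n : nat) (e : rel 'I_h).
Local Notation V := ('I_h * 'I_n)%type.
Implicit Types (L : nlift e n) (p : edgeH e) (u v : V) (F : seq (V * V)).

Definition low p (a : 'I_n) : V := ((val p).1, a).
Definition up p (a : 'I_n) : V := ((val p).2, a).

Lemma lift_adjP L u v :
  reflect (exists p a, (u = low p a /\ v = up p (L p a)) \/ (v = low p a /\ u = up p (L p a)))
    (lift_adj L u v).
Proof.
apply: (iffP existsP) => [[p /orP[]/andP[/andP[/eqP h1 /eqP h2] /eqP h3]]|[p [a [[-> ->]|[-> ->]]]]].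
- by exists p, u.2; left; rewrite /low /up -h1 -h2 -h3 -!surjective_pairing.
- by exists p, v.2; right; rewrite /low /up -h1 -h2 -h3 -!surjective_pairing.
- by exists p; rewrite !eqxx.
- by exists p; rewrite !eqxx orbT.
Qed.

Lemma lift_adjC L u v : lift_adj L u v = lift_adj L v u.
Proof.
by apply/lift_adjP/lift_adjP => -[p [a [[-> ->]|[-> ->]]]]; exists p, a; [right|left|right|left].
Qed.

Lemma edge_ltn p : (val p).1 < (val p).2.
Proof. by case: p => -[i j] /= /andP[]. Qed.

Lemma edge_eq p q : (val p).1 = (val q).1 -> (val p).2 = (val q).2 -> p = q.
Proof.
by move=> h1 h2; apply: val_inj; rewrite [LHS]surjective_pairing h1 h2 -surjective_pairing.
Qed.

Lemma low_up_inj p q a a' b b' :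
  low p a = low q a' -> up p b = up q b' -> [/\ p = q, a = a' & b = b'].
Proof. by move=> [h1 ->] [h2 ->]; split=> //; apply: edge_eq. Qed.

Lemma low_up_neq p q a a' b b' : low p a = up q b -> up p b' = low q a' -> False.
Proof.
move=> [h1 _] [h2 _]; have := ltn_trans (edge_ltn p); rewrite h2 h1 => /(_ _ (edge_ltn q)).
by rewrite ltnn.
Qed.

Lemma lift_adj_low_upE L p a b : lift_adj L (low p a) (up p b) -> L p a = b.
Proof.
case/lift_adjP => q [a' [[h1 h2]|[h1 h2]]]; last by case: (low_up_neq h2 h1).
by have [-> -> ->] := low_up_inj h1 h2.
Qed.

Lemma lift_adj_inj L u v v' : lift_adj L u v -> lift_adj L u v' -> v.1 = v'.1 -> v = v'.
Proof.
move=> /lift_adjP[p [a [[-> ->]|[-> ->]]]] /lift_adjP[q [b [[h1 ->]|[-> h1]]]] h2.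
- have [E Ea _] := @low_up_inj p q a b a a h1 (congr1 (fun i => (i, a)) h2).
  by rewrite E Ea.
- by case: (@low_up_neq p q a a _ a h1 (congr1 (fun i => (i, a)) h2)).
- by case: (@low_up_neq p q a b a _ (congr1 (fun i => (i, a)) h2) h1).
- have [E _ Eb] := @low_up_inj p q a a _ _ (congr1 (fun i => (i, a)) h2) h1.
  by subst q; move/perm_inj: Eb => ->.
Qed.

Definition containing F := [set L : nlift e n | all (fun f => lift_adj L f.1 f.2) F].
Definition unordered F : seq {set V} := [seq [set f.1; f.2] | f <- F].

(* Composing the matching of [p] with [tperm b b'] moves the edge from [low p a] to
   any of the upper endpoints [b'] not used by [F]. *)
Lemma containing_cons_low_up p a b F : [set low p a; up p b] \notin unordered F ->
  #|containing ((low p a, up p b) :: F)| * (n - size F) <= #|containing F|.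
Proof.
move=> notin.
(* For an edge in the matching of [p], [g] is its label in the upper fibre. On other edges the value
   is arbitrary: it can only remove labels from [B]. *)
pose g (f : V * V) := if f.1.1 == (val p).2 then f.1.2 else f.2.2.
pose B := ~: [set b' in map g F].
have cB : n - size F <= #|B|.
  have := cardsC [set b' in map g F]; rewrite card_ord -/B.
  have : #|[set b' in map g F]| <= size F by rewrite cardsE -(size_map g) card_size.
  lia.
apply: (leq_trans (leq_mul (leqnn _) cB)).
rewrite -cardsX.
pose swap (x : nlift e n * 'I_n) : nlift e n :=
  [ffun q => if q == p then (x.1 q * tperm b x.2)%g else x.1 q].
have swapE L b' q : swap (L, b') q = if q == p then (L q * tperm b b')%g else L q.
  by rewrite ffunE.
(* The swap can be undone: [b'] is the new partner of [a], and cancelling the transposition restores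
   the matching. *)
rewrite -(@card_in_imset _ _ swap); last first.
  move=> [L b1] [L' b1']; rewrite !inE /= => /andP[/andP[/lift_adj_low_upE Lb _] _].
  move=> /andP[/andP[/lift_adj_low_upE Lb' _] _] E.
  have := congr1 (fun f : nlift e n => f p a) E.
  rewrite !swapE eqxx !permM Lb Lb' !tpermL => Eb; subst b1'.
  congr pair; apply/ffunP => q.
  have := congr1 (fun f : nlift e n => f q) E; rewrite !swapE.
  by case: eqP => // _ /mulIg.
apply: subset_leq_card; apply/subsetP => _ /imsetP[[L b'] + ->].
rewrite in_setX /= => /andP[]; rewrite in_set /= => /andP[/lift_adj_low_upE Lb /allP allF].
rewrite in_setC in_set => b'N; rewrite in_set; apply/allP => -[x y] fF /=.
have /= /lift_adjP[q [a2 xy]] := allF _ fF.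
have [Eq|qp] := eqVneq q p; last first.
  by apply/lift_adjP; exists q, a2; rewrite swapE (negbTE qp).
subst q.
(* An edge of [F] in this matching ends neither at [b], the new edge not being listed in [F], nor at
   [b'], by the choice of [B]; the transposition therefore keeps it. *)
have b2b : L p a2 != b.
  apply: contraNneq notin => E; have Ea : a2 = a by apply: (@perm_inj _ (L p)); rewrite Lb.
  apply/mapP; exists (x, y) => //=; rewrite -E -Ea.
  by case: xy => -[-> ->] //; rewrite setUC.
have b2b' : L p a2 != b'.
  apply: contraNneq b'N => E; apply/mapP; exists (x, y) => //; rewrite /g.
  case: xy => -[-> ->] /=; last by rewrite eqxx.
  by have := edge_ltn p; case: eqP => // ->; rewrite ltnn.
apply/lift_adjP; exists p, a2; rewrite swapE eqxx permM tpermD 1?eq_sym //.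
Qed.

Lemma containing_cons u v F : [set u; v] \notin unordered F ->
  #|containing ((u, v) :: F)| * (n - size F) <= #|containing F|.
Proof.
move=> notin.
have [->|[L]] := set_0Vmem (containing ((u, v) :: F)); first by rewrite cards0.
rewrite inE /= => /andP[/lift_adjP[p [a H]] _]; case: H notin => -[-> ->] notin.
  exact: containing_cons_low_up.
move: notin; rewrite setUC => /containing_cons_low_up; apply: leq_trans.
rewrite leq_mul2r subset_leq_card ?orbT //; apply/subsetP => L'.
by rewrite !inE /= lift_adjC.
Qed.

Lemma card_containing F m : size F <= m ->
  #|containing F| * (n - m) ^ size (undup (unordered F)) <= #|[set: nlift e n]|.
Proof.
elim: F => [|[u v] F IH] /= le_m.
  by rewrite muln1 subset_leq_card ?subsetT.
case: ifP => [_|/negbT notin] /=.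
  apply: leq_trans (IH (ltnW le_m)).
  rewrite leq_mul2r subset_leq_card ?orbT //; apply/subsetP => L'.
  by rewrite !inE /= => /andP[].
apply: leq_trans (IH (ltnW le_m)); rewrite expnS mulnA leq_mul2r; apply/orP; right.
apply: leq_trans (containing_cons notin); rewrite leq_mul2l; apply/orP; right; lia.
Qed.

Definition lift_walk L u (w : seq V) := path (lift_adj L) u w.

Lemma card_lift_walk u (w : seq V) m : size w <= m ->
  #|[set L : nlift e n | lift_walk L u w]| * (n - m) ^ nedges u w <= #|[set: nlift e n]|.
Proof.
move=> le_m; pose F := mkseq (fun t => (vtx u w t, vtx u w t.+1)) (size w).
have uF : unordered F = past u w (size w) by rewrite /unordered -map_comp.
have -> : nedges u w = size (undup (unordered F)).
  rewrite uF /nedges -(card_uniqP (undup_uniq _)); apply: eq_card => E.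
  by rewrite !inE mem_undup.
apply: leq_trans (card_containing (_ : size F <= m)); last by rewrite size_mkseq.
rewrite leq_mul2r subset_leq_card ?orbT //; apply/subsetP => L; rewrite !inE => /(pathP u) pw.
apply/allP => _ /mapP[t + ->]; rewrite mem_iota add0n => /= lt_t; exact: pw.
Qed.

Definition even_edges u (w : seq V) :=
  [forall E : {set V}, ~~ odd (count_mem E (past u w (size w)))].

Lemma lift_even_walk L u (w : seq V) : symmetric e ->
  lift_walk L u w -> even_edges u w -> even_walk e u w.
Proof.
move=> se /(pathP u) pw /forallP ev.
have adj x y : [set x; y] \in past u w (size w) -> lift_adj L x y.
  case/mapP => t; rewrite mem_iota add0n /= => lt_t /set2_inj[[-> ->]|[-> ->]].
    exact: pw.
  rewrite lift_adjC; exact: pw.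
split=> // [t lt_t|x y y' /adj xy /adj xy']; last exact: lift_adj_inj xy xy'.
have /lift_adjP[p [a]] : lift_adj L (vtx u w t) (vtx u w t.+1) by apply: pw.
have ep : e (val p).1 (val p).2 by case: (p) => -[i j] /= /andP[].
by case=> -[-> ->] //; rewrite se.
Qed.

End Lift.

Import Order.TTheory GRing.Theory Num.Theory.
Local Open Scope ring_scope.

Section EvenWalkSum.
Variables (R : realFieldType) (h n d m : nat) (e : rel 'I_h).
Local Notation V := ('I_h * 'I_n)%type.
Variable u : V.
Variable T : R.

Definition num_even_walks (L : nlift e n) :=
  #|[set w : m.-tuple V | lift_walk L u w && even_edges u w]|.

(** Exchanging the sums leaves, for each even walk, the number of lifts containing it. The walks are
    then grouped by their [8 ^ m] possible type sequences, and [T] bounds the contribution of one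
    group relative to the number of lifts. *)
Lemma sum_even_walks :
  symmetric e -> (forall i, #|[set j | e i j]| = d) -> (0 < d)%N -> (m < n)%N ->
  (forall a x v s, (a <= m)%N -> (2 * v + s <= m)%N ->
     (d ^ (v + 6 * x) * n ^ a * m ^ x * (3 * x + 2) ^ s * 2 ^ v)%N%:R
       <= T * (n - m)%N%:R ^+ (a + x)) ->
  \sum_(L : nlift e n) (num_even_walks L)%:R <= 8 ^+ m * T * #|[set: nlift e n]|%:R.
Proof.
move=> se deg d0 lt_mn bound.
pose Om : R := #|[set: nlift e n]|%:R.
have q0 : 0 < (n - m)%N%:R :> R by rewrite ltr0n subn_gt0.
pose good (w : seq V) := even_edges u w && [exists L : nlift e n, lift_walk L u w].
have step1 : \sum_(L : nlift e n) (num_even_walks L)%:R <=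
    \sum_(w : m.-tuple V | good w) Om / (n - m)%N%:R ^+ nedges u w :> R.
  rewrite -natr_sum.
  have -> : (\sum_(L : nlift e n) num_even_walks L =
     \sum_(w : m.-tuple V | good w) #|[set L : nlift e n | lift_walk L u w]|)%N.
    rewrite (eq_bigr (fun L => \sum_(w : m.-tuple V)
        (lift_walk L u w && even_edges u w : nat))%N); last first.
      move=> L _; rewrite /num_even_walks -sum1_card big_mkcond /=.
      by apply: eq_bigr => w _; rewrite inE; case: (_ && _).
    rewrite exchange_big [RHS]big_mkcond /=; apply: eq_bigr => w _.
    rewrite /good; case ev: (even_edges u w) => /=; last first.
      by rewrite big1 // => L _; rewrite andbF.
    rewrite (eq_bigr (fun L => (lift_walk L u w : nat))); last by move=> L _; rewrite andbT.
    case: existsP => [_|noL].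
      rewrite -sum1_card [RHS]big_mkcond /=; apply: eq_bigr => L _.
      by rewrite inE; case: (lift_walk _ _ _).
    rewrite big1 // => L _; case lw: (lift_walk _ _ _) => //; case: noL; by exists L.
  rewrite natr_sum; apply: ler_sum => w _.
  rewrite ler_pdivlMr ?exprn_gt0 // -natrX -natrM ler_nat.
  by apply: card_lift_walk; rewrite size_tuple.
apply: le_trans step1 _.
pose ty (w : m.-tuple V) : m.-tuple (bool * bool * bool) :=
  [tuple of [seq step_type u w t | t <- iota_tuple m 0]].
rewrite (partition_big ty xpredT) //=.
have -> : 8 ^+ m * T * Om = \sum_(tt : m.-tuple (bool * bool * bool)) T * Om.
  have c8 : #|{: m.-tuple (bool * bool * bool)}| = (8 ^ m)%N.
    by rewrite card_tuple !card_prod card_bool.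
  by rewrite sumr_const c8 -[RHS]mulr_natl natrX mulrA.
apply: ler_sum => tt _.
pose th t := nth (false, false, false) tt t.
have tyE (w : m.-tuple V) : ty w == tt -> forall t, (t < m)%N -> step_type u w t = th t.
  move=> /eqP E t lt_t; rewrite /th -E /=.
  by rewrite (nth_map 0%N) ?size_iota // nth_iota // add0n.
pose P (w : seq V) := good w && ([seq step_type u w t | t <- iota 0 m] == tt).
have PT (w : seq V) : size w = m -> P w -> of_type e u th w.
  move=> sz /andP[/andP[ev /existsP[L Lw]] /eqP Et]; split; first exact: lift_even_walk Lw ev.
  move=> t; rewrite sz => lt_t; rewrite /th -Et.
  by rewrite (nth_map 0%N) ?size_iota // nth_iota // add0n.
have [a [v [s [am aE vsm card_le]]]] := card_of_type deg d0 PT.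
(* The types determine the number of distinct edges, so the weight is constant on a group. *)
have ned (w : m.-tuple V) : good w && (ty w == tt) -> nedges u w = nfirst m th.
  move=> /andP[_ /tyE tw]; rewrite nedgesE size_tuple; apply: eq_bigr => i _.
  by rewrite -tw.
rewrite (eq_bigr (fun=> Om / (n - m)%N%:R ^+ nfirst m th)); last by move=> w /ned ->.
rewrite (eq_bigl (mem [set w : m.-tuple V | P w])); last first.
  by move=> w; rewrite /= in_set /P -val_eqE.
rewrite sumr_const -[leLHS]mulr_natl mulrA ler_pdivrMr ?exprn_gt0 // mulrAC ler_wpM2r ?ler0n //.
rewrite -aE; have B0 := bound a (nexcess m th) v s am vsm.
by apply: le_trans B0; rewrite ler_nat.
Qed.

End EvenWalkSum.

(** * Traces and sign averages *)

(** Lagrange's identity. *)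
Lemma sum_cauchy_schwarz (R : realFieldType) (I : finType) (a b : I -> R) :
  (\sum_i a i * b i) ^+ 2 <= (\sum_i a i ^+ 2) * (\sum_i b i ^+ 2).
Proof.
have h : \sum_i \sum_j (a i * b j - a j * b i) ^+ 2 =
    2 * ((\sum_i a i ^+ 2) * (\sum_i b i ^+ 2)) - 2 * (\sum_i a i * b i) ^+ 2.
  have E i j : (a i * b j - a j * b i) ^+ 2 =
     (a i ^+ 2 * b j ^+ 2 + b i ^+ 2 * a j ^+ 2) - 2 * ((a i * b i) * (a j * b j)).
    by ring.
  under eq_bigr do under eq_bigr do rewrite E.
  under eq_bigr do rewrite big_split big_split sumrN -!mulr_sumr /=.
  rewrite big_split big_split sumrN /= -!mulr_sumr -!mulr_suml; ring.
have : 0 <= \sum_i \sum_j (a i * b j - a j * b i) ^+ 2.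
  by do 2!apply: sumr_ge0 => ? _; apply: sqr_ge0.
rewrite h; lra.
Qed.

(** For [t < -1] and [m > 0] the left side is at most zero, while an even power is nonnegative. *)
Lemma bernoulli_even (R : realFieldType) (t : R) m : ~~ odd m -> 1 + m%:R * t <= (1 + t) ^+ m.
Proof.
move=> ev; have [t1|t1] := lerP (-1) t.
  elim: m {ev} => [|m IH]; first by rewrite expr0 mul0r addr0.
  rewrite exprS; apply: le_trans (_ : (1 + t) * (1 + m%:R * t) <= _); last first.
    by rewrite ler_wpM2l //; lra.
  have : 0 <= m%:R * t ^+ 2 by rewrite mulr_ge0 ?ler0n ?sqr_ge0.
  rewrite -natr1; lra.
have p0 : 0 <= (1 + t) ^+ m by rewrite exprn_even_ge0.
case: m ev p0 => [_ _|m _ p0]; first by rewrite expr0 mul0r addr0.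
apply: le_trans p0; have : 0 <= m%:R * - t by rewrite mulr_ge0 ?ler0n //; lra.
rewrite -natr1; lra.
Qed.

(** Tangent line at the mean [mu]: [bernoulli_even] is applied to each [y i / mu - 1], and these
    deviations sum to zero. *)
Lemma jensen_even (R : realFieldType) (I : finType) (y : I -> R) m : ~~ odd m -> (0 < m)%N ->
  (0 < #|I|)%N -> ((\sum_i y i) / #|I|%:R) ^+ m <= (\sum_i y i ^+ m) / #|I|%:R.
Proof.
move=> ev m0 I0; set N : R := #|I|%:R; have N0 : 0 < N by rewrite ltr0n.
set mu := _ / N; have [mu0|mu0] := eqVneq mu 0.
  rewrite mu0 expr0n eqn0Ngt m0 /= divr_ge0 ?(ltW N0) //.
  by apply: sumr_ge0 => i _; rewrite exprn_even_ge0.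
rewrite ler_pdivlMr //.
have yE i : y i = mu * (1 + (y i / mu - 1)) by field.
have sE : \sum_i (y i / mu - 1) = 0.
  rewrite sumrB -mulr_suml sumr_const -/N.
  have -> : \sum_i y i = mu * N by rewrite /mu divfK // gt_eqF.
  by rewrite mulrAC divff // mul1r subrr.
have -> : mu ^+ m * N = \sum_i mu ^+ m * (1 + m%:R * (y i / mu - 1)).
  by rewrite -mulr_sumr big_split /= -mulr_sumr sE mulr0 addr0 sumr_const.
apply: ler_sum => i _.
have -> : y i ^+ m = mu ^+ m * (1 + (y i / mu - 1)) ^+ m by rewrite -exprMn -yE.
rewrite ler_wpM2l ?exprn_even_ge0 //.
exact: bernoulli_even.
Qed.

Lemma exprD_le_even (R : realFieldType) (a b : R) m : ~~ odd m ->
  (a + b) ^+ m <= 2 ^+ m * (a ^+ m + b ^+ m).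
Proof.
move=> ev.
have ge0 (x : R) : 0 <= x ^+ m by rewrite exprn_even_ge0.
have nE (x : R) : x ^+ m = `|x| ^+ m by rewrite -normrX ger0_norm.
rewrite nE (nE a) (nE b).
wlog le_ab : a b / `|a| <= `|b|.
  move=> H; case: (lerP `|a| `|b|) => [|/ltW]; first exact: H.
  by rewrite addrC [X in _ * X]addrC; apply: H.
apply: le_trans (_ : (2 * `|b|) ^+ m <= _).
  rewrite lerXn2r ?nnegrE ?mulr_ge0 ?normr_ge0 //.
  by apply: le_trans (ler_normD a b) _; lra.
by rewrite exprMn ler_wpM2l ?exprn_ge0 // lerDr exprn_ge0.
Qed.

Section KernelPower.
Variables (R : realFieldType) (V : finType) (B : V -> V -> R).

Fixpoint kpow k u v : R :=
  if k is k'.+1 then \sum_w B u w * kpow k' w v else (u == v)%:R.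

Definition ktrace k := \sum_u kpow k u u.

Definition kact k (z : V -> R) u := \sum_v kpow k u v * z v.

Lemma sum_delta (f : V -> R) u : \sum_v (u == v)%:R * f v = f u.
Proof.
rewrite (bigD1 u) //= eqxx mul1r big1 ?addr0 // => v.
by rewrite eq_sym => /negbTE ->; rewrite mul0r.
Qed.

Lemma kpowD j k u v : kpow (j + k) u v = \sum_w kpow j u w * kpow k w v.
Proof.
elim: j u => [|j IH] u /=; first by rewrite sum_delta.
under eq_bigr do rewrite IH mulr_sumr.
rewrite exchange_big /=; apply: eq_bigr => w _.
by rewrite mulr_suml; apply: eq_bigr => y _; rewrite mulrA.
Qed.

Lemma kpow1 u v : kpow 1 u v = B u v.
Proof.
rewrite /= -[RHS](sum_delta (fun w => B u w)).
rewrite (eq_bigr (fun w => (v == w)%:R * B u w)) ?sum_delta // => w _.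
by rewrite eq_sym mulrC.
Qed.

Lemma kactD j k z u : kact (j + k) z u = \sum_w kpow j u w * kact k z w.
Proof.
rewrite /kact; under eq_bigr do rewrite kpowD mulr_suml.
rewrite exchange_big; apply: eq_bigr => w _.
by rewrite mulr_sumr; apply: eq_bigr => v _; rewrite mulrA.
Qed.

Hypothesis symB : forall u v, B u v = B v u.

Lemma kpow_sym k u v : kpow k u v = kpow k v u.
Proof.
elim: k u v => [|k IH] u v; first by rewrite /= eq_sym.
rewrite -[in RHS]addn1 kpowD /=; apply: eq_bigr => w _.
by rewrite -/(kpow 1 w u) kpow1 symB IH mulrC.
Qed.

Lemma dot_kact j k z :
  \sum_u kact j z u * kact k z u = \sum_u z u * kact (j + k) z u.
Proof.
under [RHS]eq_bigr do rewrite kactD mulr_sumr.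
rewrite exchange_big; apply: eq_bigr => w _ /=.
rewrite /kact mulr_suml; apply: eq_bigr => u _.
by rewrite kpow_sym; ring.
Qed.

Lemma ktrace_double k : ktrace (k + k) = \sum_u \sum_v kpow k u v ^+ 2.
Proof.
apply: eq_bigr => u _; rewrite kpowD; apply: eq_bigr => v _.
by rewrite [kpow k v u]kpow_sym expr2.
Qed.

Lemma ktrace_ge0 k : 0 <= ktrace (k + k).
Proof. by rewrite ktrace_double; do 2!apply: sumr_ge0 => ? _; apply: sqr_ge0. Qed.

(** A spectral bound obtained without diagonalisation. The squared norms [g j] of [B ^ j z] are
    log-convex by Cauchy-Schwarz, hence [g 1 ^ k <= g 0 ^ (k - 1) * g k]. Moreover [g k] is at most
    [g 0] times the squared Frobenius norm of [B ^ k], which is the trace of [B ^ (2 k)]. *)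
Lemma form_le_ktrace z k : (0 < k)%N ->
  (\sum_u \sum_v B u v * (z u * z v)) ^+ (k + k) <=
    (\sum_u z u ^+ 2) ^+ (k + k) * ktrace (k + k).
Proof.
case: k => // k _.
pose g j := \sum_u kact j z u ^+ 2.
have g_ge0 j : 0 <= g j by apply: sumr_ge0 => u _; apply: sqr_ge0.
have gE j : g j = \sum_u z u * kact (j + j) z u.
  by rewrite -dot_kact; apply: eq_bigr => u _; rewrite expr2.
have kact0 u : kact 0 z u = z u by rewrite /kact sum_delta.
have g0 : g 0%N = \sum_u z u ^+ 2 by apply: eq_bigr => u _; rewrite kact0.
have cs j : g j.+1 ^+ 2 <= g j * g j.+2.
  have -> : g j.+1 = \sum_u kact j z u * kact j.+2 z u.
    by rewrite gE dot_kact; apply: eq_bigr => u _; congr (_ * kact _ _ _); lia.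
  exact: sum_cauchy_schwarz.
have ratio j : g 1%N * g j <= g 0%N * g j.+1.
  elim: j => [|j IH]; first by rewrite mulrC.
  (* The induction divides by [g j]; if it vanishes, so does [g j.+1]. *)
  have := g_ge0 j; rewrite le_eqVlt => /orP[/eqP z0|gj].
    have -> : g j.+1 = 0.
      by apply/eqP; rewrite -sqrf_eq0 eq_le sqr_ge0 andbT (le_trans (cs j)) // -z0 mul0r.
    by rewrite mulr0 mulr_ge0.
  rewrite -(ler_pM2r gj).
  apply: le_trans (_ : (g 0%N * g j.+1) * g j.+1 <= _).
    by rewrite mulrAC ler_wpM2r.
  by rewrite -!mulrA ler_wpM2l // -expr2 mulrC.
have pow j : g 1%N ^+ j.+1 <= g 0%N ^+ j * g j.+1.
  elim: j => [|j IH]; first by rewrite expr1 expr0 mul1r.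
  rewrite exprS; apply: le_trans (_ : g 1%N * (g 0%N ^+ j * g j.+1) <= _).
    by rewrite ler_wpM2l.
  by rewrite mulrCA [g 0%N ^+ j.+1]exprSr -mulrA ler_wpM2l ?exprn_ge0.
have last : g k.+1 <= g 0%N * ktrace (k.+1 + k.+1).
  rewrite ktrace_double mulr_sumr; apply: ler_sum => u _; rewrite g0 mulrC.
  by rewrite /kact; apply: sum_cauchy_schwarz.
have form : \sum_u \sum_v B u v * (z u * z v) = \sum_u z u * kact 1 z u.
  apply: eq_bigr => u _; rewrite /kact mulr_sumr; apply: eq_bigr => v _.
  by rewrite kpow1; ring.
rewrite form addnn -mul2n exprM.
apply: le_trans (_ : (g 0%N * g 1%N) ^+ k.+1 <= _).
  rewrite lerXn2r ?nnegrE ?sqr_ge0 ?mulr_ge0 // g0.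
  exact: sum_cauchy_schwarz.
rewrite exprMn -g0 mul2n -addnn exprD -mulrA ler_wpM2l ?exprn_ge0 //.
apply: le_trans (pow k) _; rewrite exprSr -mulrA ler_wpM2l ?exprn_ge0 //.
Qed.

Lemma sum_tuple_cons m (F : seq V -> R) :
  \sum_(w : m.+1.-tuple V) F w = \sum_v \sum_(w : m.-tuple V) F (v :: w).
Proof.
rewrite pair_big /=.
rewrite (reindex (fun x : V * m.-tuple V => [tuple of x.1 :: x.2])) //=.
exists (fun w : m.+1.-tuple V => (thead w, [tuple of behead w])) => [[v w] _|w _] /=.
  by congr pair; apply: val_inj.
by rewrite -tuple_eta.
Qed.

Lemma kpow_walks m u v :
  kpow m u v = \sum_(w : m.-tuple V | last u w == v)
    \prod_(t < m) B (vtx u w t) (vtx u w t.+1).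
Proof.
elim: m u => [|m IH] u.
  rewrite big_mkcond (big_pred1 [tuple]) /=; last by move=> w; symmetry; apply/eqP; apply: tuple0.
  by rewrite big_ord0; case: eqP.
rewrite big_mkcond (sum_tuple_cons _ (fun w => if last u w == v
   then \prod_(t < m.+1) B (vtx u w t) (vtx u w t.+1) else 0)) /=.
apply: eq_bigr => x _; rewrite IH mulr_sumr [LHS]big_mkcond /=; apply: eq_bigr => w _.
case: ifP => // _.
rewrite big_ord_recl; congr (_ * _).
apply: eq_bigr => t _; rewrite !lift0.
by congr (B _ _); apply: set_nth_default; rewrite /= size_tuple ltnS // ltnW.
Qed.

End KernelPower.

(** The sum factors over [K]: a sign used an odd number of times contributes [1 + (-1) = 0], any
    other sign contributes 2. *)
Lemma sum_signs (R : realFieldType) (K : finType) m (k : 'I_m -> K) :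
  \sum_(s : {ffun K -> bool}) \prod_(i < m) (-1) ^+ s (k i) =
  if [forall x, ~~ odd #|[set i | k i == x]|] then 2 ^+ #|K| else 0 :> R.
Proof.
have E (s : {ffun K -> bool}) : \prod_(i < m) (-1) ^+ s (k i) =
    \prod_x (-1) ^+ (s x * #|[set i | k i == x]|) :> R.
  rewrite (partition_big k xpredT) //=; apply: eq_bigr => x _.
  rewrite (eq_bigr (fun=> (-1) ^+ s x)); last by move=> i /eqP ->.
  by rewrite exprM -prodr_const; apply: eq_bigl => i; rewrite inE.
under eq_bigr do rewrite E.
rewrite -(bigA_distr_bigA (fun x (b : bool) => (-1) ^+ (b * #|[set i | k i == x]|))) /=.
under eq_bigr do rewrite big_bool /= mul1n mul0n expr0.
case: ifP => [/forallP ev|/forallPn[x]].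
  rewrite (eq_bigr (fun=> 2)) ?prodr_const ?cardT // => x _.
  by rewrite -signr_odd (negbTE (ev x)) expr0.
rewrite negbK => od; rewrite (bigD1 x) //= -signr_odd od expr1 addNr mul0r //.
Qed.

Section Signed.
Variables (R : realFieldType) (h n : nat) (e : rel 'I_h).
Local Notation V := ('I_h * 'I_n)%type.
Local Notation K := ('I_h * 'I_h * 'I_n)%type.
Implicit Types (L : nlift e n) (u v : V) (z x : V -> R).

Lemma sum_lift_adj L (F : V -> V -> R) :
  \sum_u \sum_v (if lift_adj L u v then F u v else 0) =
  \sum_(p : edgeH e) \sum_a (F (low p a) (up p (L p a)) + F (up p (L p a)) (low p a)).
Proof.
pose f (x : edgeH e * 'I_n) := (low x.1 x.2, up x.1 (L x.1 x.2)).
pose f' (x : edgeH e * 'I_n) := (up x.1 (L x.1 x.2), low x.1 x.2).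
have f_inj : injective f.
  by move=> [p a] [q b] [] /= h1 -> h3 h4; congr pair; apply: edge_eq.
have f'_inj : injective f'.
  by move=> [p a] [q b] [] /= h1 h2 h3 ->; congr pair; apply: edge_eq.
rewrite pair_big /= -big_mkcond /=.
have adjE : [set x : V * V | lift_adj L x.1 x.2] = (f @: setT) :|: (f' @: setT).
  apply/setP => -[u v]; rewrite inE /=; apply/lift_adjP/setUP.
    by move=> [p [a [[-> ->]|[-> ->]]]]; [left|right]; apply/imsetP; exists (p, a).
  by case=> /imsetP[[p a] _ [-> ->]]; exists p, a; [left|right].
have dis : [disjoint f @: setT & f' @: setT].
  rewrite -setI_eq0; apply/eqP/setP => x; rewrite !inE; apply/negP.
  case/andP => /imsetP[[p a] _ ->] /imsetP[[q b] _ [h1 h2 h3 h4]].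
  by apply: (@low_up_neq _ _ _ p q a a a a); rewrite /low /up ?h1 ?h3.
rewrite (eq_bigl [in [predU f @: setT & f' @: setT]]); last first.
  by move=> x; have /= := congr1 (fun S : {set V * V} => x \in S) adjE; rewrite in_setU in_set inE.
rewrite bigU //=.
rewrite (big_imset _ (in2W f_inj)) (big_imset _ (in2W f'_inj)) /=.
by rewrite -big_split pair_big /=; apply: eq_bigl => x; rewrite inE.
Qed.

(** A name for the edge that records only its label in the lower fibre, so the index set of the
    signs is the same for all lifts. *)
Definition key u v : K := if (u.1 < v.1)%N then (u.1, v.1, u.2) else (v.1, u.1, v.2).

Lemma key_low_up (p : edgeH e) a b : key (low p a) (up p b) = ((val p).1, (val p).2, a) :> K.
Proof. by rewrite /key /= edge_ltn. Qed.

Lemma key_up_low (p : edgeH e) a b : key (up p b) (low p a) = ((val p).1, (val p).2, a) :> K.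
Proof. by rewrite /key /= ltnNge ltnW ?edge_ltn. Qed.

Lemma key_sym L u v : lift_adj L u v -> key u v = key v u.
Proof. by case/lift_adjP => p [a [[-> ->]|[-> ->]]]; rewrite key_low_up key_up_low. Qed.

Lemma key_inj L u v u' v' : lift_adj L u v -> lift_adj L u' v' -> key u v = key u' v' ->
  [set u; v] = [set u'; v'].
Proof.
move=> /lift_adjP[p [a E]] /lift_adjP[q [b E']].
have -> : key u v = ((val p).1, (val p).2, a).
  by case: E => -[-> ->]; rewrite (key_low_up, key_up_low).
have -> : key u' v' = ((val q).1, (val q).2, b).
  by case: E' => -[-> ->]; rewrite (key_low_up, key_up_low).
case=> h1 h2 h3; have Epq : p = q by apply: edge_eq.
by subst q b; case: E => -[-> ->]; case: E' => -[-> ->]; rewrite // setUC.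
Qed.

Variables (Q : pred K) (r : K -> K).

(** [Q] selects a part of the edges and [r] allows several edges to share one sign. *)
Definition signed L (s : {ffun K -> bool}) u v : R :=
  if lift_adj L u v && Q (key u v) then (-1) ^+ s (r (key u v)) else 0.

Lemma signed_sym L s u v : signed L s u v = signed L s v u.
Proof.
rewrite /signed lift_adjC; case adj: (lift_adj L v u) => //=.
by rewrite (key_sym adj).
Qed.

Lemma signed_form L s z :
  \sum_u \sum_v signed L s u v * (z u * z v) =
  2 * \sum_(p : edgeH e) \sum_a
    (if Q ((val p).1, (val p).2, a) then (-1) ^+ s (r ((val p).1, (val p).2, a)) else 0) *
    (z (low p a) * z (up p (L p a))).
Proof.
rewrite (eq_bigr (fun u => \sum_v if lift_adj L u v then
   (if Q (key u v) then (-1) ^+ s (r (key u v)) else 0) * (z u * z v) else 0)); last first.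
  move=> u _; apply: eq_bigr => v _; rewrite /signed.
  by case: (lift_adj L u v); rewrite /= ?mul0r.
rewrite sum_lift_adj mulr_sumr; apply: eq_bigr => p _.
rewrite mulr_sumr; apply: eq_bigr => a _.
by rewrite key_low_up key_up_low [z (up _ _) * _]mulrC -mulr2n mulr_natl.
Qed.

Hypothesis r_inj : {in Q &, injective r}.

(** Expanding the trace into walks, the sum over signs kills every walk that uses some sign an odd
    number of times. Since [r] is injective on [Q], the edges of a surviving walk carry distinct
    signs, so each edge is used an even number of times. *)
Lemma sum_ktrace_signed L m :
  \sum_s ktrace (signed L s) m <= 2 ^+ #|{: K}| * \sum_u (num_even_walks m u L)%:R.
Proof.
rewrite /ktrace exchange_big mulr_sumr; apply: ler_sum => u _.
under eq_bigr do rewrite kpow_walks.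
rewrite exchange_big /=.
rewrite /num_even_walks -sum1_card natr_sum mulr_sumr.
rewrite big_mkcond [X in _ <= X]big_mkcond /=; apply: ler_sum => w _.
have p0 : 0 <= 2 ^+ #|{: K}| * 1%:R :> R by rewrite mulr1 exprn_ge0.
case: ifP => [_|_]; last by case: ifP.
pose k (t : 'I_m) := key (vtx u w t) (vtx u w t.+1).
have [/forallP ok|/forallPn[t0 bad]] :=
  boolP [forall t : 'I_m, lift_adj L (vtx u w t) (vtx u w t.+1) && Q (k t)]; last first.
  rewrite big1 => [|s _]; first by case: ifP.
  by rewrite (bigD1 t0) //= /signed (negbTE bad) mul0r.
rewrite (eq_bigr (fun s : {ffun K -> bool} => \prod_(t < m) (-1) ^+ s (r (k t)))); last first.
  by move=> s _; apply: eq_bigr => t _; rewrite /signed ok.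
rewrite (sum_signs R (fun t => r (k t))).
case: ifP => [/forallP ev|_]; last by case: ifP.
have -> : w \in [set w : m.-tuple V | lift_walk L u w && even_edges u w]; last by rewrite mulr1.
rewrite inE; apply/andP; split.
  apply/(pathP u) => t; rewrite size_tuple => lt_t.
  by have /andP[] := ok (Ordinal lt_t).
apply/forallP => E; rewrite size_tuple.
have [/mapP[t + ->]|/count_memPn -> //] := boolP (E \in past u w m).
rewrite mem_iota add0n /= => lt_t; pose t0 := Ordinal lt_t.
have := ev (r (k t0)); congr (~~ odd _).
have -> : count_mem (edg u w t) (past u w m) = (\sum_(i < m | edg u w i == edg u w t) 1)%N.
  by rewrite -(big_mkord (fun i => edg u w i == edg u w t) (fun=> 1%N)) /index_iota subn0 sum1_count count_map.
rewrite -sum1_card; apply: eq_bigl => i; rewrite inE /=.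
have /andP[adj_i Qi] := ok i; have /andP[adj_t Qt] := ok t0.
apply/eqP/eqP => [/(r_inj Qi Qt) kE|E']; first exact: key_inj adj_i adj_t kE.
congr r; rewrite /k; case: (set2_inj E') => -[-> ->] //.
exact/esym/(key_sym adj_t).
Qed.

End Signed.

(** * Symmetrisation by random reflections *)

Section Symmetrisation.
Variables (R : realFieldType) (h n' : nat) (e : rel 'I_h).
Local Notation n := n'.+1.
Local Notation V := ('I_h * 'I_n)%type.
Local Notation K := ('I_h * 'I_h * 'I_n)%type.
Implicit Types (L : nlift e n) (u v : V) (z x : V -> R) (c : {ffun 'I_h -> 'I_n}).

Definition form L z := \sum_(p : edgeH e) \sum_a z (low p a) * z (up p (L p a)).

(** Subtraction modulo [n]; the form [n'.+1] of [n] provides this group structure on ['I_n]. *)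
Definition refl c i (a : 'I_n) : 'I_n := c i - a.

Lemma reflK c i : involutive (refl c i).
Proof. by move=> a; rewrite /refl subKr. Qed.

Definition antisym c x u := x u - x (u.1, refl c u.1 u.2).

Lemma antisym_refl c x i a : antisym c x (i, refl c i a) = - antisym c x (i, a).
Proof. by rewrite /antisym /= reflK opprB. Qed.

Lemma norm_antisym c x : \sum_u antisym c x u ^+ 2 <= 4 * \sum_u x u ^+ 2.
Proof.
have E : \sum_u x (u.1, refl c u.1 u.2) ^+ 2 = \sum_u x u ^+ 2.
  rewrite [RHS](reindex_inj (h := fun u : V => (u.1, refl c u.1 u.2))) //=.
  by apply: inv_inj => -[i a] /=; rewrite reflK.
apply: le_trans (_ : \sum_u (2 * x u ^+ 2 + 2 * x (u.1, refl c u.1 u.2) ^+ 2) <= _).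
  apply: ler_sum => u _; rewrite /antisym.
  have := sqr_ge0 (x u + x (u.1, refl c u.1 u.2)); lra.
by rewrite big_split -!mulr_sumr E /=; lra.
Qed.

(** Shifting [c i] by every [k] leaves [G] unchanged while the argument of [x] runs through the
    whole fibre, where [x] sums to zero. *)
Lemma sum_refl_eq0 x i a (G : {ffun 'I_h -> 'I_n} -> R) :
  \sum_b x (i, b) = 0 ->
  (forall (c : {ffun 'I_h -> 'I_n}) k, G [ffun j => c j + (if j == i then k else 0)] = G c) ->
  \sum_(c : {ffun 'I_h -> 'I_n}) x (i, refl c i a) * G c = 0.
Proof.
move=> bal Ginv; set S := LHS.
have S_shift k : S = \sum_(c : {ffun 'I_h -> 'I_n}) x (i, c i + k - a) * G c.
  pose f k c : {ffun 'I_h -> 'I_n} := [ffun j => c j + (if j == i then k else 0)].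
  have fK : cancel (f k) (f (- k)).
    by move=> c; apply/ffunP => j; rewrite !ffunE; case: eqP => _; rewrite ?addrK ?addr0.
  rewrite /S (reindex_inj (can_inj fK)); apply: eq_bigr => c _.
  by rewrite Ginv /refl ffunE eqxx.
have : S *+ #|'I_n| = 0.
  rewrite -sumr_const (eq_bigr (fun k => \sum_(c : {ffun 'I_h -> 'I_n}) x (i, c i + k - a) * G c)); last first.
    by move=> k _; apply: S_shift.
  rewrite exchange_big big1 // => c _; rewrite -mulr_suml.
  rewrite (_ : \sum_k _ = 0) ?mul0r // -[RHS]bal.
  rewrite [RHS](reindex_inj (h := fun k => c i + k - a)) //=.
  by move=> k k' /addIr/addrI.
by move/eqP; rewrite mulrn_eq0 card_ord /= => /eqP.
Qed.

(** Of the four terms of the expanded product, those with a reflected factor average to zero; for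
    the doubly reflected one this uses the independence of [c i] and [c j]. *)
Lemma sum_antisym x i j a b : (forall i, \sum_a x (i, a) = 0) -> i != j ->
  \sum_(c : {ffun 'I_h -> 'I_n}) antisym c x (i, a) * antisym c x (j, b) =
  #|{ffun 'I_h -> 'I_n}|%:R * (x (i, a) * x (j, b)).
Proof.
move=> bal neq.
have Z k d (G : {ffun 'I_h -> 'I_n} -> R) :
    (forall (c : {ffun 'I_h -> 'I_n}) l, G [ffun j => c j + (if j == k then l else 0)] = G c) ->
    \sum_(c : {ffun 'I_h -> 'I_n}) x (k, refl c k d) * G c = 0 by apply: sum_refl_eq0.
rewrite (eq_bigr (fun c : {ffun 'I_h -> 'I_n} => x (i, a) * x (j, b) - x (j, refl c j b) * x (i, a)
   - x (i, refl c i a) * x (j, b) + x (i, refl c i a) * x (j, refl c j b))); last first.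
  by move=> c _; rewrite /antisym /=; ring.
rewrite !big_split !sumrN /=.
rewrite (Z j b (fun=> x (i, a))) // (Z i a (fun=> x (j, b))) //.
rewrite (Z i a (fun c : {ffun 'I_h -> 'I_n} => x (j, refl c j b))); last first.
  by move=> c l; rewrite /refl ffunE eq_sym (negbTE neq) addr0.
by rewrite oppr0 !addr0 sumr_const mulr_natl.
Qed.

Lemma sum_form_antisym L x : (forall i, \sum_a x (i, a) = 0) ->
  \sum_(c : {ffun 'I_h -> 'I_n}) form L (antisym c x) = #|{ffun 'I_h -> 'I_n}|%:R * form L x.
Proof.
move=> bal; rewrite /form exchange_big mulr_sumr; apply: eq_bigr => p _.
rewrite exchange_big mulr_sumr; apply: eq_bigr => a _ /=.
rewrite sum_antisym //; apply/eqP => E; have := edge_ltn p; by rewrite E ltnn.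
Qed.

Definition rep c i (a : 'I_n) : 'I_n := if (a <= refl c i a)%N then a else refl c i a.

(** The sign belongs to the whole pair, because a transposition moves both of its members. *)
Definition rep_key c (k : K) : K := (k.1, rep c k.1.1 k.2).

(* Each pair [{a, c i - a}] carries a single sign, so the signs are independent only
   after restricting to one half of every pair. *)
Definition low_half c : pred K := fun k => (k.2 <= refl c k.1.1 k.2)%N.

Lemma rep_refl c i a : rep c i (refl c i a) = rep c i a.
Proof.
rewrite /rep reflK; case: (ltngtP a (refl c i a)) => // /ord_inj.
by move=> <-.
Qed.

Lemma rep_key_inj_low c : {in low_half c &, injective (rep_key c)}.
Proof.
move=> [[i j] a] [[i' j'] a']; rewrite !unfold_in /low_half /rep_key /rep /=.
by move=> -> ->.
Qed.

Lemma rep_key_inj_high c : {in predC (low_half c) &, injective (rep_key c)}.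
Proof.
move=> [[i j] a] [[i' j'] a']; rewrite !unfold_in /low_half /rep_key /rep /=.
move=> /negbTE la /negbTE la' E.
have Ei : i = i' := congr1 (fun k => k.1.1) E; have Ej : j = j' := congr1 (fun k => k.1.2) E.
have := congr1 snd E; rewrite /= la la' Ei => /(inv_inj (reflK c i')) ->; by rewrite Ej.
Qed.

Definition flip c (s : {ffun K -> bool}) (p : edgeH e) (a : 'I_n) : 'I_n :=
  if s ((val p).1, (val p).2, rep c (val p).1 a) then refl c (val p).1 a else a.

Lemma flipK c s p : involutive (flip c s p).
Proof.
move=> a; rewrite /flip; case E: (s (_, rep c _ a)); last by rewrite E.
by rewrite rep_refl E reflK.
Qed.

Definition twist c s L : nlift e n :=
  [ffun p => (perm (inv_inj (flipK c s p)) * L p)%g].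

Lemma twistE c s L p a : twist c s L p a = L p (flip c s p a).
Proof. by rewrite ffunE permM permE. Qed.

(** As an involution, [twist c s] permutes the lifts, which is the invariance of the uniform law. *)
Lemma twistK c s : involutive (twist c s).
Proof. by move=> L; apply/ffunP => p; apply/permP => a; rewrite !twistE flipK. Qed.

Definition low_kernel c := @signed R h n e (low_half c) (rep_key c).
Definition high_kernel c := @signed R h n e (predC (low_half c)) (rep_key c).

(** Reindexing by [flip] moves the twist from the lift to [z], where antisymmetry turns it into a
    sign. Each edge belongs to exactly one of the two halves. *)
Lemma form_twist c s L x : let z := antisym c x in
  2 * form (twist c s L) z =
  \sum_u \sum_v low_kernel c L s u v * (z u * z v) +
  \sum_u \sum_v high_kernel c L s u v * (z u * z v).
Proof.
move=> z; rewrite !signed_form -mulrDr; congr (_ * _); rewrite -big_split /=.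
apply: eq_bigr => p _; rewrite -big_split /=.
rewrite (reindex_inj (inv_inj (flipK c s p))) /=; apply: eq_bigr => a _.
rewrite twistE flipK.
have -> : z (low p (flip c s p a)) =
    (-1) ^+ s (rep_key c ((val p).1, (val p).2, a)) * z (low p a).
  rewrite /flip /rep_key /=; case: (s _) => /=; rewrite ?expr1 ?expr0 ?mul1r //.
  by rewrite /z /low antisym_refl mulN1r.
rewrite /predC /=; case: (low_half _ _) => /=; ring.
Qed.

Definition trace_pair c m L s := ktrace (low_kernel c L s) m + ktrace (high_kernel c L s) m.

(** The constant is [8 = 2 * 4]: the factor 2 comes from splitting into two halves, the 4 from
    [norm_antisym]. *)
Lemma form_twist_le c s L x k : (0 < k)%N ->
  (2 * form (twist c s L) (antisym c x)) ^+ (k + k) <=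
  8 ^+ (k + k) * (\sum_u x u ^+ 2) ^+ (k + k) * trace_pair c (k + k) L s.
Proof.
move=> k0; rewrite form_twist; set z := antisym c x.
have ev : ~~ odd (k + k) by rewrite addnn odd_double.
apply: le_trans (exprD_le_even _ _ ev) _.
have zx : (\sum_u z u ^+ 2) ^+ (k + k) <= 4 ^+ (k + k) * (\sum_u x u ^+ 2) ^+ (k + k).
  rewrite -exprMn lerXn2r ?nnegrE ?mulr_ge0 ?sumr_ge0 ?norm_antisym // => u _; exact: sqr_ge0.
have hl := form_le_ktrace (@signed_sym R h n e (low_half c) (rep_key c) L s) z k0.
have hh := form_le_ktrace (@signed_sym R h n e (predC (low_half c)) (rep_key c) L s) z k0.
have tl := ktrace_ge0 (@signed_sym R h n e (low_half c) (rep_key c) L s) k.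
have th := ktrace_ge0 (@signed_sym R h n e (predC (low_half c)) (rep_key c) L s) k.
have -> : 8 ^+ (k + k) = 2 ^+ (k + k) * 4 ^+ (k + k) :> R.
  by rewrite -exprMn; congr (_ ^+ _); ring.
rewrite -!mulrA ler_wpM2l ?exprn_ge0 // mulrA /trace_pair mulrDr lerD //.
  by apply: le_trans hl _; rewrite ler_wpM2r.
by apply: le_trans hh _; rewrite ler_wpM2r.
Qed.

Lemma sum_trace_pair c L m :
  \sum_(s : {ffun K -> bool}) trace_pair c m L s <= 2 * (2 ^+ #|{: K}| * \sum_u (num_even_walks m u L)%:R).
Proof.
rewrite big_split /= mulr_natl mulr2n lerD // sum_ktrace_signed //.
  exact: rep_key_inj_low.
exact: rep_key_inj_high.
Qed.

(** Markov's inequality for the moment of order [k + k], with Jensen over the reflections. The test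
    vector depends on the lift, but [trace_pair] does not mention it, so the sum over all lifts can
    be taken afterwards. *)
Lemma bad_lifts_le (Bad : {set nlift e n}) (Theta : R) k : (0 < k)%N -> 0 < Theta ->
  (forall L, L \in Bad -> exists x lam,
     [/\ forall i, \sum_a x (i, a) = 0, 0 < \sum_u x u ^+ 2, Theta <= `|lam| &
         2 * form L x = lam * \sum_u x u ^+ 2]) ->
  #|Bad|%:R * Theta ^+ (k + k) <=
  2 * 8 ^+ (k + k) * \sum_u \sum_(L : nlift e n) (num_even_walks (k + k) u L)%:R.
Proof.
move=> k0 Th0 bad; set m := (k + k)%N.
have ev : ~~ odd m by rewrite /m addnn odd_double.
have m0 : (0 < m)%N by rewrite /m addn_gt0 k0.
pose C := #|{ffun 'I_h -> 'I_n}|; pose E : R := 2 ^+ #|{: K}|.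
have C0 : (0 < C)%N by rewrite /C card_ffun !card_ord expn_gt0.
have CR : 0 < C%:R :> R by rewrite ltr0n.
have E0 : 0 < E by rewrite exprn_gt0.
have cardE : #|{ffun K -> bool}|%:R = E :> R by rewrite card_ffun card_bool natrX.
have tp_ge0 c s L : 0 <= trace_pair c m L s.
  by rewrite addr_ge0 // ktrace_ge0 // => u v; apply: signed_sym.
have key_ineq L : L \in Bad -> Theta ^+ m * (C%:R * E) <=
    8 ^+ m * \sum_(c : {ffun 'I_h -> 'I_n}) \sum_(s : {ffun K -> bool}) trace_pair c m (twist c s L) s.
  move=> /bad[x [lam [bal x0 Thl form_x]]].
  set X := \sum_u x u ^+ 2 in x0 form_x.
  have Xm : 0 < X ^+ m by rewrite exprn_gt0.
  (* By [twistK], [L] is itself the twist of [twist c s L], which makes its form a signed one for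
     every [s]. *)
  have ptw c s : (2 * form L (antisym c x)) ^+ m <=
      8 ^+ m * X ^+ m * trace_pair c m (twist c s L) s.
    by rewrite -{1}(twistK c s L); apply: form_twist_le.
  have avg : (\sum_(c : {ffun 'I_h -> 'I_n}) 2 * form L (antisym c x)) / C%:R = lam * X.
    by rewrite -mulr_sumr sum_form_antisym // mulrCA form_x mulrAC divff ?mul1r ?gt_eqF.
  have := jensen_even (fun c : {ffun 'I_h -> 'I_n} => 2 * form L (antisym c x)) ev m0 C0.
  rewrite avg -/C ler_pdivlMr // => jen.
  have le1 : Theta ^+ m * X ^+ m <= (lam * X) ^+ m.
    rewrite exprMn ler_wpM2r ?(ltW Xm) //.
    have -> : lam ^+ m = `|lam| ^+ m by rewrite -normrX ger0_norm ?exprn_even_ge0.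
    by rewrite lerXn2r ?nnegrE ?normr_ge0 ?(ltW Th0).
  rewrite -(ler_pM2r Xm).
  apply: le_trans (_ : \sum_(c : {ffun 'I_h -> 'I_n}) \sum_(s : {ffun K -> bool}) (2 * form L (antisym c x)) ^+ m <= _).
    rewrite (eq_bigr (fun c => (2 * form L (antisym c x)) ^+ m * E)); last first.
      by move=> c _; rewrite sumr_const -[LHS]mulr_natr cardE.
    rewrite -mulr_suml.
    have -> : Theta ^+ m * (C%:R * E) * X ^+ m = Theta ^+ m * X ^+ m * C%:R * E by ring.
    rewrite ler_wpM2r ?(ltW E0) //; apply: le_trans jen.
    by rewrite ler_wpM2r ?(ltW CR).
  rewrite mulrAC [leRHS]mulr_sumr; apply: ler_sum => c _; rewrite [leRHS]mulr_sumr; apply: ler_sum => s _.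
  exact: ptw.
have CE0 : 0 < C%:R * E by rewrite mulr_gt0.
rewrite -(ler_pM2r CE0).
apply: le_trans (_ : \sum_(L in Bad) Theta ^+ m * (C%:R * E) <= _).
  by rewrite sumr_const -[leRHS]mulr_natl mulrA.
apply: le_trans (_ : \sum_(L : nlift e n) 8 ^+ m * \sum_(c : {ffun 'I_h -> 'I_n}) \sum_(s : {ffun K -> bool}) trace_pair c m (twist c s L) s <= _).
  rewrite big_mkcond; apply: ler_sum => L _; case: ifP => [|_]; first exact: key_ineq.
  by rewrite mulr_ge0 ?exprn_ge0 //; do 2!apply: sumr_ge0 => ? _.
rewrite -mulr_sumr exchange_big /=.
(* For fixed [c] and [s] the sum over all lifts absorbs the twist, leaving signs independent of the
   lift. *)
rewrite (eq_bigr (fun c : {ffun 'I_h -> 'I_n} => \sum_(L : nlift e n) \sum_(s : {ffun K -> bool}) trace_pair c m L s)); last first.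
  move=> c _; rewrite exchange_big [RHS]exchange_big; apply: eq_bigr => s _ /=.
  by rewrite [RHS](reindex_inj (inv_inj (twistK c s))).
apply: le_trans (_ : 8 ^+ m * \sum_(c : {ffun 'I_h -> 'I_n}) \sum_L
     2 * (E * \sum_u (num_even_walks m u L)%:R) <= _).
  rewrite ler_wpM2l ?exprn_ge0 //; do 2!apply: ler_sum => ? _; exact: sum_trace_pair.
rewrite sumr_const -[X in _ * X]mulr_natr -/C -!mulr_sumr [X in E * X]exchange_big /=.
by rewrite le_eqVlt; apply/orP; left; apply/eqP; ring.
Qed.

End Symmetrisation.

(** * Conclusion *)

(** Here [n ^ a] costs only a factor 2 over [(n - m) ^ a], the factors [2 * d] and [b] combine to at
    most [b ^ m] since [2 * v + s <= m], and everything exponential in [x] is absorbed by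
    [(n - m) ^ x]. *)
Lemma cost_le (R : realFieldType) (n m d : nat) (b K0 K1 : R) : (m < n)%N ->
  1 <= b -> 2 * d%:R <= b ^+ 2 -> 0 <= K0 -> 0 <= K1 ->
  n%:R ^+ m <= 2 * (n%:R - m%:R) ^+ m :> R ->
  (forall x s, (s <= m)%N -> (3 * x%:R + 2) ^+ s <= b ^+ s * K0 * K1 ^+ x) ->
  m%:R * d%:R ^+ 6 * K1 <= n%:R - m%:R ->
  forall a x v s, (a <= m)%N -> (2 * v + s <= m)%N ->
     (d ^ (v + 6 * x) * n ^ a * m ^ x * (3 * x + 2) ^ s * 2 ^ v)%N%:R
       <= 2 * b ^+ m * K0 * (n - m)%N%:R ^+ (a + x).
Proof.
move=> lt_mn b1 db K00 K10 nm affine growth a x v s am vsm.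
have le_mn := ltnW lt_mn; rewrite natrB //.
set q : R := n%:R - m%:R in nm growth *.
have q0 : 0 < q by rewrite subr_gt0 ltr_nat.
have b0 : 0 <= b by apply: le_trans b1.
have na : n%:R ^+ a <= 2 * q ^+ a.
  have qma : 0 < q ^+ (m - a) by rewrite exprn_gt0.
  rewrite -(ler_pM2r qma) -mulrA -exprD subnKC //; apply: le_trans nm.
  rewrite -{2}(subnKC am) exprD ler_wpM2l ?exprn_ge0 ?ler0n //.
  by rewrite lerXn2r ?nnegrE ?ler0n ?(ltW q0) // /q lerBlDr lerDl ler0n.
have dv : (2 * d%:R) ^+ v * b ^+ s <= b ^+ m.
  apply: le_trans (_ : b ^+ (2 * v) * b ^+ s <= _).
    by rewrite ler_wpM2r ?exprn_ge0 // exprM lerXn2r ?nnegrE ?mulr_ge0 ?ler0n ?exprn_ge0.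
  by rewrite -exprD ler_weXn2l.
have gx : (m%:R * d%:R ^+ 6) ^+ x * K1 ^+ x <= q ^+ x.
  by rewrite -exprMn lerXn2r ?nnegrE ?mulr_ge0 ?exprn_ge0 ?ler0n // ltW.
have sm : (s <= m)%N by apply: leq_trans vsm; rewrite leq_addl.
have -> : (d ^ (v + 6 * x) * n ^ a * m ^ x * (3 * x + 2) ^ s * 2 ^ v)%N%:R =
    (2 * d%:R) ^+ v * (m%:R * d%:R ^+ 6) ^+ x * n%:R ^+ a * (3 * x%:R + 2) ^+ s :> R.
  rewrite !natrM !natrX natrD natrM exprD exprM [(2 * _) ^+ v]exprMn [(m%:R * _) ^+ x]exprMn; ring.
apply: le_trans (_ : (2 * d%:R) ^+ v * (m%:R * d%:R ^+ 6) ^+ x * (2 * q ^+ a) *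
   (b ^+ s * K0 * K1 ^+ x) <= _).
  have P0 : 0 <= (2 * d%:R) ^+ v * (m%:R * d%:R ^+ 6) ^+ x :> R.
    by rewrite mulr_ge0 ?exprn_ge0 ?mulr_ge0 ?exprn_ge0 ?ler0n.
  apply: ler_pM; rewrite ?mulr_ge0 ?exprn_ge0 ?addr_ge0 ?mulr_ge0 ?ler0n //.
    by rewrite ler_wpM2l.
  exact: affine.
have -> : (2 * d%:R) ^+ v * (m%:R * d%:R ^+ 6) ^+ x * (2 * q ^+ a) * (b ^+ s * K0 * K1 ^+ x) =
   ((2 * d%:R) ^+ v * b ^+ s) * ((m%:R * d%:R ^+ 6) ^+ x * K1 ^+ x) * (2 * q ^+ a * K0) by ring.
have -> : 2 * b ^+ m * K0 * q ^+ (a + x) = b ^+ m * q ^+ x * (2 * q ^+ a * K0).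
  by rewrite exprD; ring.
rewrite ler_wpM2r ?mulr_ge0 ?exprn_ge0 ?(ltW q0) //.
by apply: ler_pM; rewrite ?mulr_ge0 ?exprn_ge0 ?mulr_ge0 ?exprn_ge0 ?ler0n.
Qed.

(** The Rayleigh identity; the factor 2 appears because [form] counts each edge of the lift once. *)
Lemma new_eigenvalue_form h n (e : rel 'I_h) (L : nlift e n.+1) (lam : R) :
  new_eigenvalue L lam -> exists x : 'I_h * 'I_n.+1 -> R,
  [/\ forall i, \sum_a x (i, a) = 0, 0 < \sum_u x u ^+ 2 &
      2 * form L x = lam * \sum_u x u ^+ 2].
Proof.
move=> [x [bal [[v0 v0N] eig]]]; exists x; split=> //.
  rewrite lt_neqAle sumr_ge0 ?andbT => [|u _]; last exact: sqr_ge0.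
  apply/eqP => /esym/eqP; rewrite psumr_eq0 => [/allP/(_ v0)|u _]; last exact: sqr_ge0.
  by rewrite mem_index_enum sqrf_eq0 => /(_ isT)/eqP.
rewrite mulr_sumr.
have -> : 2 * form L x = \sum_u \sum_v (if lift_adj L u v then x u * x v else 0).
  rewrite (sum_lift_adj L (fun u v => x u * x v)) /form mulr_sumr; apply: eq_bigr => p _.
  rewrite mulr_sumr; apply: eq_bigr => a _; rewrite [x (up _ _) * _]mulrC; ring.
apply: eq_bigr => u _.
have E : \sum_v adj_mx L u v * x v = lam * x u := eig u.
rewrite expr2 mulrCA -E mulr_sumr; apply: eq_bigr => v _.
by rewrite /adj_mx; case: ifP => _; rewrite ?mul1r // mul0r mulr0.
Qed.

Lemma asboolE (P : Prop) : reflect P (asbool P).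
Proof. by rewrite /asbool; case: excluded_middle_informative => h; constructor. Qed.

(** The constant [64 = 8 * 8] joins the symmetrisation loss to the number of step types; [4 = 2 * 2]
    joins the two halves to the factor 2 in [cost_le], and [h * n] counts the starting vertices. *)
Lemma card_bad_le d h n (e : rel 'I_h) k (b K0 K1 rho : R) : let m := (k + k)%N in
  d_regular d e -> (0 < d)%N -> (0 < k)%N -> (m < n)%N ->
  1 <= b -> 2 * d%:R <= b ^+ 2 -> 0 <= K0 -> 0 <= K1 ->
  n%:R ^+ m <= 2 * (n%:R - m%:R) ^+ m :> R ->
  (forall x s, (s <= m)%N -> (3 * x%:R + 2) ^+ s <= b ^+ s * K0 * K1 ^+ x) ->
  m%:R * d%:R ^+ 6 * K1 <= n%:R - m%:R ->
  forall Theta : R, 0 < Theta ->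
  4 * h%:R * n%:R * 64 ^+ m * b ^+ m * K0 <= rho * Theta ^+ m ->
  #|~: [set L : nlift e n | asbool (lambda_star_le L Theta)]|%:R
     <= rho * #|[set: nlift e n]|%:R.
Proof.
move=> m [se [_ deg]] d0 k0; case: n => [//|n] lt_mn b1 db K00 K10 nm affine growth Theta Th0 fin.
set Bad := ~: _; set Om : R := #|[set: nlift e n.+1]|%:R.
have bad L : L \in Bad -> exists x lam,
     [/\ forall i, \sum_a x (i, a) = 0, 0 < \sum_u x u ^+ 2, Theta <= `|lam| &
         2 * form L x = lam * \sum_u x u ^+ 2].
  rewrite !inE => /asboolE nle.
  have [lam nle_lam] := not_all_ex_not _ _ nle; have [eig gt] := imply_to_and _ _ nle_lam.
  have [x [x1 x2 x3]] := new_eigenvalue_form eig.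
  exists x, lam; split=> //; rewrite -RabsE; apply/RleP/Rlt_le/Rnot_le_lt; exact: gt.
have main := bad_lifts_le k0 Th0 bad.
have bound := cost_le lt_mn b1 db K00 K10 nm affine growth.
have T0 : 0 < Theta ^+ m by rewrite exprn_gt0.
rewrite -(ler_pM2r T0); apply: le_trans main _.
apply: le_trans (_ : 2 * 8 ^+ m * \sum_(u : 'I_h * 'I_n.+1) 8 ^+ m * (2 * b ^+ m * K0) * Om <= _).
  rewrite ler_wpM2l ?mulr_ge0 ?exprn_ge0 //; apply: ler_sum => u _.
  exact: sum_even_walks.
rewrite sumr_const -[X in _ * X]mulr_natl card_prod !card_ord natrM.
have -> : 2 * 8 ^+ m * (h%:R * n.+1%:R * (8 ^+ m * (2 * b ^+ m * K0) * Om)) =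
   (4 * h%:R * n.+1%:R * 64 ^+ m * b ^+ m * K0) * Om.
  have -> : 64 ^+ m = 8 ^+ m * 8 ^+ m :> R by rewrite -exprMn; congr (_ ^+ _); ring.
  ring.
by rewrite [leRHS]mulrAC ler_wpM2r ?ler0n.
Qed.

(* [ring_scope] took over the delimiter [%R]. *)
Delimit Scope R_scope with R.

Theorem theorem1 (d h : nat) (e : rel 'I_h) :
  (2 <= d)%N -> d_regular d e ->
  exists N : nat, forall n : nat, (N <= n)%N ->
    (lift_prob (fun L : nlift e n => lambda_star_le L (430656 * sqrt (INR d))%R)
      >= 1 - Rpower (INR n) (- (2 * sqrt (INR d))))%R.
Proof.
move=> d2 reg; have d2' : le 2 d by apply/ssrnat.leP.
have [N HN] := @exists_walk_length d h d2'.
exists N => n /ssrnat.leP /HN[k [K0 [K1 H]]]; cbv zeta in H.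
case: H => [k0 [mn [K00 [K10 [nm [affine [growth fin]]]]]]].
have D2 : Rle 2 (INR d) by apply: (le_INR 2).
have s0 : Rlt 0 (sqrt (INR d)) by apply: sqrt_lt_R0; Lra.lra.
have ss : Rmult (sqrt (INR d)) (sqrt (INR d)) = INR d by apply: sqrt_sqrt; Lra.lra.
set good := [set L : nlift e n | asbool (lambda_star_le L (430656 * sqrt (INR d))%R)].
set rho := Rpower _ _ in fin *.
(* Real numerals are integer casts in one notation and natural multiples of 1 in the other; these
   equations translate between them. *)
have e2 : IZR 2 = 2 :> R by rewrite IZRposE INRE.
have e3 : IZR 3 = 3 :> R by rewrite IZRposE INRE.
have e4 : IZR 4 = 4 :> R by rewrite IZRposE INRE.
have e64 : IZR 64 = 64 :> R by rewrite IZRposE INRE.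
pose toR := (RpowE, RmultE, RminusE, RplusE, INRE, e2, e3, e4, e64).
have le_bad : Rle (INR #|~: good|) (Rmult rho (INR #|[set: nlift e n]|)).
  rewrite !INRE; apply/RleP.
  apply: (@card_bad_le d h n e k (Rmult 2 (sqrt (INR d))) K0 K1 rho) => //.
  - exact: ltnW.
  - exact/ssrnat.ltP.
  - exact/ssrnat.ltP.
  - by apply/RleP; change (Rle (IZR 1) (Rmult 2 (sqrt (INR d)))); Lra.nra.
  - have : Rle (Rmult 2 (INR d)) (pow (Rmult 2 (sqrt (INR d))) 2) by simpl; Lra.nra.
    by move/RleP; rewrite !toR.
  - by apply/ltW/RltP.
  - by apply/ltW/RltP.
  - by move/RleP: nm; rewrite !toR.
  - by move=> x s /ssrnat.leP le_s; move/RleP: (affine x s le_s); rewrite !toR.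
  - by move/RleP: growth; rewrite !toR.
  - by apply/RltP; change (Rlt (IZR 0) (Rmult 430656 (sqrt (INR d)))); Lra.nra.
  - by move/RleP: fin; rewrite !toR.
have Om0 : Rlt 0 (INR #|[set: nlift e n]|).
  apply: lt_0_INR; apply/ssrnat.ltP; rewrite cardsT; apply/card_gt0P.
  by exists [ffun=> 1%g].
have card_eq : Rplus (INR #|good|) (INR #|~: good|) = INR #|[set: nlift e n]|.
  by rewrite -plus_INR cardsT -(cardsC good).
apply: Rle_ge; rewrite /lift_prob -/good.
apply: (Rmult_le_reg_r _ _ _ Om0); rewrite /Rdiv Rmult_assoc Rinv_l; last Lra.lra.
Lra.lra.
Qed.
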